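(* Let $S$ be a Polish space and let $\nu$ be a positive (possibly infinite) Radon measure on $S$. Let $1<p\le\infty$, let $f_n\in L^p_+(\nu)$ for $n\in\mathbb{N}$, and put $\mu_n:=f_n\,d\nu\in\mathcal{M}^+(S)$. Suppose that $\mu_n\to\mu_*$ in the weak topology on measures, where $\mu_*\in\mathcal{M}(S)$. Then the following holds: (i) There exists a $\sigma$-compact set $S_*\subset S$ on which all $\mu_n$ and $\mu_*$ are concentrated. The Borel measure $\nu_*$ defined by $\nu_*(E):=\nu(E\cap S_* )$ for any Borel set $E\subset S$ is $\sigma$-finite. (ii) If $M:=\liminf_{n\to\infty}\|f_n\|_{L^p(\nu)}<\infty$, then $\mu_*$ is absolutely continuous with respect to $\nu_*$ and hence with respect to $\nu$. The Radon-Nikodym derivative $f_*$ of $\mu_*$ with respect to $\nu_*$ is in $L^p(S,\nu_* )$, with $\|f_*\|_{L^p(\nu_* )}\le M$. In particular, $\mu_*=f\,d\nu$ with $f:=f_*\mathbf{1}_{S_*}\in L^p_+(\nu)$ and $\|f\|_{L^p(\nu)}\le M$.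
   Context: A Polish space is a separable completely metrizable topological space, equipped with its Borel $\sigma$-algebra. $\mathcal{M}(S)$ is the vector space of finite signed Borel measures on $S$ and $\mathcal{M}^+(S)$ the cone of positive measures in it. The weak topology on measures is the one induced by the pairing $\langle\mu,f\rangle=\int_S f\,d\mu$ of $\mathcal{M}(S)$ with the space $C_b(S)$ of bounded continuous real functions. A positive (possibly infinite) Radon measure on $S$ is a Borel measure $\nu$ that is (a) finite on compact sets; (b) outer regular on all Borel sets $E$: $\nu(E)=\inf\{\nu(U): U\subset S \text{ open}, E\subset U\}$; (c) inner regular on all open sets $U$: $\nu(U)=\sup\{\nu(K): K\subset U \text{ compact}\}$. It is not assumed to be $\sigma$-finite. $L^p_+(\nu):=\{f\in L^1(S,\nu)\cap L^p(S,\nu): f\ge 0\ \nu\text{-a.e.}\}$. A measure $\mu$ is concentrated on a Borel set $S_*$ if $|\mu|(S\setminus S_* )=0$. $\mathbf{1}_{A}$ denotes the indicator function of $A$. *)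

(* Defs.v *)
From HB Require Import structures.
From mathcomp Require Import all_boot all_order all_algebra.
From mathcomp Require Import all_classical all_reals all_analysis.

Set Implicit Arguments.
Unset Strict Implicit.
Unset Printing Implicit Defensive.

Import Order.TTheory GRing.Theory Num.Theory.
Import numFieldNormedType.Exports.

Local Open Scope classical_set_scope.
Local Open Scope ring_scope.

Section polish_space.

Definition separable (S : topologicalType) :=
  exists2 D : set S, countable D & dense D.

(* The topology of [S] is the one transported from a metric space [M] that is
   complete, i.e. in which every proper Cauchy filter converges. *)
Definition completely_metrizable (R : realType) (S : topologicalType) :=
  exists (M : metricType R) (h : S -> M) (g : M -> S),
    [/\ cancel h g, cancel g h, continuous h, continuous g &
        forall F : set_system M, ProperFilter F -> cauchy F -> exists l : M, F --> l].

Definition polish (R : realType) (S : topologicalType) :=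
  separable S /\ completely_metrizable R S.

Definition sigma_compact (S : topologicalType) (A : set S) :=
  exists2 K : (set S)^nat, (forall n, compact (K n)) & A = \bigcup_n K n.

End polish_space.

(* A copy of [S] with its topology and its Borel sigma-algebra. Measurable
   types being pointed in the library, so is [S]. *)
Definition borel (S : ptopologicalType) : Type := S.

HB.instance Definition _ (S : ptopologicalType) :=
  PointedTopological.copy (borel S) S.
HB.instance Definition _ (S : ptopologicalType) :=
  Measurable.copy (borel S) (g_sigma_algebraType (@open S)).

Section radon_measure.
Context (R : realType) (S : ptopologicalType).
Local Open Scope ereal_scope.

Definition radon (nu : {measure set (borel S) -> \bar R}) :=
  [/\ forall K : set (borel S), compact K -> nu K < +oo,
      forall E : set (borel S), measurable E ->
        nu E = ereal_inf [set nu U | U in [set U | open U /\ E `<=` U]] &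
      forall U : set (borel S), open U ->
        nu U = ereal_sup [set nu K | K in [set K | compact K /\ K `<=` U]]].

End radon_measure.

Section signed_measure.
Context d (T : measurableType d) (R : realType).
Implicit Type mu : {charge set T -> \bar R}.

Definition hahn_pos mu : set T := sval (cid (Hahn_decomposition mu)).

Definition hahn_neg mu : set T :=
  sval (cid (svalP (cid (Hahn_decomposition mu)))).

Definition hahnP mu : hahn_decomposition mu (hahn_pos mu) (hahn_neg mu) :=
  svalP (cid (svalP (cid (Hahn_decomposition mu)))).

Definition total_variation mu : {measure set T -> \bar R} :=
  charge_variation (hahnP mu).

Definition concentrated mu (A : set T) := total_variation mu (~` A) = 0%E.

(* Integration against a charge, through its Jordan decomposition; it does not
   depend on the chosen Hahn decomposition. *)
Definition charge_integral mu (g : T -> R) : R :=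
  \int[jordan_pos (hahnP mu)]_x g x - \int[jordan_neg (hahnP mu)]_x g x.

End signed_measure.

Section weak_topology.
Context (R : realType) (S : ptopologicalType).

Definition bounded_continuous : Type :=
  {g : borel S -> R | continuous g /\ bounded_fun g}.

Definition signed_measure : Type := {charge set (borel S) -> \bar R}.

HB.instance Definition _ := gen_eqMixin signed_measure.
HB.instance Definition _ := gen_choiceMixin signed_measure.

Definition pairing (mu : signed_measure) : {ptws bounded_continuous -> R} :=
  fun g => charge_integral mu (sval g).

(* The coarsest topology on signed measures for which all the maps
   [mu |-> \int g dmu], [g] bounded and continuous, are continuous. *)
Definition weak_measures := initial_topology pairing.

HB.instance Definition _ := Topological.on weak_measures.

End weak_topology.

Section Lp_plus.
Context d (T : measurableType d) (R : realType).
Implicit Types (nu : {measure set T -> \bar R}) (p : \bar R) (f : T -> R).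

Definition Lp_plus nu p : set (T -> R) :=
  [set f | [/\ f \in Lfun nu 1, f \in Lfun nu p & \forall x \ae nu, 0 <= f x]].

Lemma Lp_plus_integrable nu p f :
  Lp_plus nu p f -> nu.-integrable [set: T] (EFin \o f).
Proof. by move=> [/Lfun1_integrable]. Qed.

(* The measure [f dnu]. *)
Definition density nu p f (fp : Lp_plus nu p f) : {charge set T -> \bar R} :=
  induced_charge (Lp_plus_integrable fp).

End Lp_plus.

Section sigma_finite_restriction.
Context d (T : measurableType d) (R : realType).
Variables (nu : {measure set T -> \bar R}) (D : set T) (mD : measurable D).

Definition sfmrestr (sf : sigma_finite [set: T] (mrestr nu mD)) :=
  mrestr nu mD.

Variable sf : sigma_finite [set: T] (mrestr nu mD).

HB.instance Definition _ := Measure.copy (sfmrestr sf) (mrestr nu mD).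
HB.instance Definition _ :=
  @Measure_isSigmaFinite.Build d T R (sfmrestr sf) sf.

(* [A |-> nu (A `&` D)] packaged as a sigma-finite measure, as required by the
   library's Radon-Nikodym derivative. *)
Definition sigma_finite_mrestr : {sigma_finite_measure set T -> \bar R} :=
  sfmrestr sf.

End sigma_finite_restriction.

(* Main.v *)
Require Import Defs.
From HB Require Import structures.
From mathcomp Require Import all_boot all_order all_algebra.
From mathcomp Require Import all_classical all_reals all_analysis.
From mathcomp Require Import measurable_realfun ess_sup_inf ring.
Set Implicit Arguments.
Unset Strict Implicit.
Unset Printing Implicit Defensive.
Import Order.TTheory GRing.Theory Num.Theory.
Import numFieldNormedType.Exports.
Local Open Scope classical_set_scope.
Local Open Scope ring_scope.
Local Open Scope ereal_scope.
Local Open Scope charge_scope.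

(** Part (i) is tightness: each of the countably many finite measures involved
    is carried by a countable union of compact sets ([ulam_tightness]), and
    [nu] is finite on each of these.

    For part (ii) the obstacle is that weak convergence only tests against
    bounded continuous functions, while absolute continuity and the norm of a
    density are statements about Borel sets. The bridge is an inequality stable
    under both passages. For [M' > M], infinitely many [n] satisfy
    [||f_n||_p <= M'], and then Young's inequality gives, for continuous
    [g >= 0],
      [int g f_n dnu <= M'^p / p + int g^q / q dnu]
    (for [p = oo]: [int g f_n dnu <= M' int g dnu]). The right-hand side does
    not depend on [n], so the inequality survives the weak limit:
      [int g dmu* <= C + int Psi(g) dnu], with [C] and [Psi] depending on [M'].
    Outer regularity of [nu] then carries it from continuous functions to
    all Borel [phi >= 0] vanishing off a set of finite [nu]-measure
    ([integral_bound_transfer]): a simple function is dominated by an increasing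
    limit of continuous functions which differs from it on a set of arbitrarily
    small [nu]-measure.

    Testing with [phi = t 1_E], [nu(E) = 0], [t] large, gives absolute
    continuity. Testing with [phi = h^(p-1)], where [h] is the density truncated
    in height and to a compact set, gives [int h^p <= C + int h^p / q], that is
    [int h^p <= M'^p]: Young's inequality loses nothing in this case. Letting
    the truncation go to infinity and [M'] to [M] bounds the norm.

    The same transfer principle, with [C = 0], [Psi = id] and the positive part
    of [mu*] in place of [nu], shows that [mu*] is a positive measure. It
    applies because finite Borel measures on metrizable spaces are outer
    regular ([finite_outer_regular]). *)

(** * Topology of completely metrizable spaces *)

Section polish_topology.
Variable R : realType.
Local Open Scope ring_scope.

(** Take the distance to the closed set; when the set is empty this distance is
    infinite, and a positive constant serves instead. *)
Lemma closed_zero_set_metric (M : metricType R) (A : set M) : closed A ->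
  exists d : M -> R, [/\ continuous d, forall x, 0 <= d x &
    forall x, d x = 0 <-> A x].
Proof.
move=> cA; have [A0|/set0P[a Aa]] := eqVneq A set0.
  exists (fun=> 1); split=> [x| |x]; [exact: cvg_cst|by []|].
  by rewrite A0; split=> // /eqP; rewrite oner_eq0.
have dfin x : edist_inf A x \is a fin_num.
  rewrite ge0_fin_numE ?edist_inf_ge0//.
  apply: (@le_lt_trans _ _ (edist (x, a))).
    by apply: ereal_inf_lbound; exists a.
  rewrite -ge0_fin_numE ?edist_ge0//; apply/edist_finP.
  exists (mdist x a + 1) => /=; first by rewrite ltr_wpDl ?mdist_ge0.
  by rewrite ballEmdist/= ltrDl.
exists (fun x => fine (edist_inf A x)); split=> [x|x|x].
- by apply: fine_cvg; rewrite fineK//; exact: edist_inf_continuous.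
- by rewrite fine_ge0// edist_inf_ge0.
split=> [dx0|Ax]; last by rewrite edist_inf0.
have {}dx0 : edist_inf A x = 0%E by rewrite -(fineK (dfin x)) dx0.
apply: cA => B /nbhs_ballP[e /= e0 eB].
have : (edist_inf A x < e%:E)%E by rewrite dx0 lte_fin.
move=> /ereal_inf_lt[_ [b Ab <-] xb]; exists b; split => //; apply: eB.
exact: (edist_lt_ball (xy := (x, b))).
Qed.

Lemma closed_zero_set (S : topologicalType) (A : set S) :
  completely_metrizable R S -> closed A ->
  exists d : S -> R, [/\ continuous d, forall x, 0 <= d x &
    forall x, d x = 0 <-> A x].
Proof.
move=> [M [h [g [hK gK ch cg _]]]] cA.
have cB : closed (g @^-1` A) by apply: preimage_closed => // x _; exact: cg.
have [d [cd d0 dA]] := closed_zero_set_metric cB.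
exists (d \o h); split=> [x|x|x] /=; [|exact: d0|].
- by apply: continuous_comp; [exact: ch|exact: cd].
- by rewrite dA /preimage/= hK.
Qed.

(** With [d] vanishing exactly off [U], the functions [min 1 (k d)] increase to
    the indicator of [U]. *)
Lemma open_indic_sup (S : topologicalType) (U : set S) :
  completely_metrizable R S -> open U ->
  exists u : nat -> S -> R, [/\ forall k, continuous (u k),
    forall k x, 0 <= u k x, forall x, nondecreasing_seq (u ^~ x) &
    forall x, u k x @[k --> \oo] --> (\1_U x : R)].
Proof.
move=> mS oU; have [|d [cd d0 dU]] := closed_zero_set mS (A := ~` U).
  exact: open_closedC.
exists (fun k x => Num.min 1 (k%:R * d x)); split=> [k x|k x|x m n mn|x].
- have := @continuous_min R S (fun=> 1) (fun x => k%:R * d x) x.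
  by apply; [exact: cvg_cst|apply: cvgMr; exact: cd].
- by rewrite le_min ler01/= mulr_ge0.
- by rewrite le_min ge_min lexx/= ge_min ler_wpM2r ?ler_nat ?orbT.
have [Ux|nUx] := pselect (U x); last first.
  rewrite indicE memNset// (_ : d x = 0); last exact/dU.
  by under eq_fun do rewrite mulr0 min_r//; exact: cvg_cst.
rewrite indicE mem_set//.
have dx : 0 < d x.
  by rewrite lt_neqAle d0 andbT eq_sym; apply/eqP => /dU; exact.
apply: cvg_near_cst; near=> k.
apply/min_idPl; rewrite -ler_pdivrMr// mul1r.
near: k; exact: nbhs_infty_ger.
Unshelve. all: by end_near. Qed.

Lemma completely_metrizable_hausdorff (S : topologicalType) :
  completely_metrizable R S -> hausdorff_space S.
Proof.
move=> [M [h [g [hK gK ch cg _]]]] p q pq.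
rewrite -(hK p) -(hK q); congr g; apply: (@metric_hausdorff R M) => A B pA qB.
have [x [Ax Bx]] := pq _ _ (ch p _ pA) (ch q _ qB).
by exists (h x).
Qed.

(** A closed totally bounded set is compact: an ultrafilter on it contains, for
    every [k], one of the finitely many sets [C k i] of radius [1 / (k + 1)], so
    that it is Cauchy. *)
Lemma compact_of_finite_nets (S : topologicalType) (M : metricType R)
    (h : S -> M) (g : M -> S) (C : nat -> nat -> set S) (n : nat -> nat)
    (e : nat -> S) :
  cancel h g -> cancel g h -> continuous h -> continuous g ->
  (forall F : set_system M, ProperFilter F -> cauchy F ->
     exists l : M, F --> l) ->
  (forall k i, closed (C k i)) ->
  (forall k i x, C k i x -> mdist (h (e i)) (h x) <= k.+1%:R^-1) ->
  compact (\bigcap_k \big[setU/set0]_(i < n k) C k i).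
Proof.
move=> hK gK ch cg cpl cC C_h; rewrite compact_ultra => F UF FK.
have PF : ProperFilter F by exact: ultra_proper.
have cK : closed (\bigcap_k \big[setU/set0]_(i < n k) C k i).
  apply: closed_bigI => k _; apply: closed_bigsetU => i _; exact: cC.
have ultraU : forall k m, F (\big[setU/set0]_(i < m) C k i) ->
    exists i : nat, F (C k i).
  move=> k; elim=> [|m IH].
    by rewrite big_ord0 => /filter_ex[].
  rewrite big_ord_recr/= => FU.
  have [?|FN] := in_ultra_setVsetC (C k m) UF; first by exists m.
  apply: IH; apply: filterS (filterI FU FN) => x [[]//] ? ?; contradiction.
have : cauchy (h x @[x --> F]).
  apply/cauchy_exP => r /= r0.
  have [k kr] : exists k : nat, k.+1%:R^-1 < r.
    have [k _ /(_ k (leqnn _)) kr] := near_infty_natSinv_lt (PosNum r0).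
    by exists k.
  have [i FC] : exists i : nat, F (C k i).
    by apply: (ultraU k (n k)); apply: filterS FK => x; exact.
  exists (h (e i)); rewrite /fmap/=; apply: filterS FC => x Cx /=.
  by rewrite ballEmdist/=; exact: le_lt_trans (C_h _ _ _ Cx) kr.
move=> /cpl[l hl]; exists (g l).
have Fgl : F --> g l.
  have : (g \o h) x @[x --> F] --> g l.
    exact: (cvg_comp _ _ hl (cg l)).
  by under eq_fun do rewrite /= hK.
split=> //=.
exact: (@closed_cvg _ _ F _ id _ cK FK (g l)).
Qed.

End polish_topology.

(** * Regularity and tightness of finite Borel measures *)

Section borel_sets.
Variable S : ptopologicalType.

Lemma open_borel_measurable (U : set (borel S)) : open U -> measurable U.
Proof. by move=> oU; exact: sub_sigma_algebra. Qed.

Lemma closed_borel_measurable (C : set (borel S)) : closed C -> measurable C.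
Proof.
move=> cC; rewrite -(setCK C); apply: measurableC.
by apply: open_borel_measurable; exact: closed_openC.
Qed.

Lemma continuous_borel_measurable (R : realType) (g : borel S -> R) :
  continuous g -> measurable_fun [set: borel S] g.
Proof.
move=> cg; apply: (measurability _ (RGenOpens.measurableE R)).
move=> _ [_ [a [b ->] <-]]; rewrite setTI.
apply: open_borel_measurable.
by apply: open_comp; [move=> x _; exact: cg|exact: interval_open].
Qed.

End borel_sets.

Section finite_measures.
Variables (R : realType).

Lemma nonincreasing_measure_small d (T : measurableType d)
    (mu : {measure set T -> \bar R}) (F : (set T)^nat) (e : R) :
  mu [set: T] < +oo -> (forall n, measurable (F n)) -> nonincreasing_seq F ->
  mu (\bigcap_n F n) = 0 -> (0 < e)%R -> exists n, mu (F n) <= e%:E.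
Proof.
move=> muoo mF niF F0 e0.
have mI : measurable (\bigcap_n F n) by exact: bigcap_measurable.
have F0oo : mu (F 0%N) < +oo.
  by apply: le_lt_trans muoo; apply: le_measure; rewrite ?inE.
have := nonincreasing_cvg_mu F0oo mF mI niF; rewrite F0.
move=> /fine_cvgP[[N1 _ Nfin] /cvgrPdist_le /(_ e e0)[N2 _ Ne]].
exists (maxn N1 N2).
have := Ne (maxn N1 N2) (leq_maxr _ _).
rewrite /= sub0r normrN => /(le_trans (ler_norm _)).
by rewrite -lee_fin fineK//; apply: Nfin; exact: leq_maxl.
Qed.

Lemma measure_bigcup_le_geometric d (T : measurableType d)
    (mu : {measure set T -> \bar R}) (F : (set T)^nat) (e : R) :
  (0 < e)%R -> (forall n, measurable (F n)) ->
  (forall n, mu (F n) <= (e / (2 ^ n.+1)%:R)%:E) ->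
  mu (\bigcup_n F n) <= e%:E.
Proof.
move=> e0 mF Fe.
apply: (@le_trans _ _ (\sum_(n <oo) mu (F n))).
  by apply: measure_sigma_subadditive => //; exact: bigcup_measurable.
apply: (@le_trans _ _ (\sum_(n <oo) (e / (2 ^ n.+1)%:R)%:E)).
  by apply: lee_nneseries => // n _ _; exact: Fe.
exact: epsilon_trick0 (ltW e0).
Qed.

Variable S : ptopologicalType.

(** For each [k], the closed sets [C k i] of radius [1 / (k + 1)] around a dense
    sequence cover the space, so finitely many of them miss only a mass
    [e / 2^(k+1)]. The intersection over [k] of these finite unions is
    compact. *)
Lemma ulam_tightness (mu : {measure set (borel S) -> \bar R}) (e : R) :
  polish R S -> mu [set: borel S] < +oo -> (0 < e)%R ->
  exists2 K : set (borel S), compact K & mu (~` K) <= e%:E.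
Proof.
move=> [[D cD dD] [M [h [g [hK gK ch cg cpl]]]]] muoo e0.
have [s Ds] := pcard_surjP cD.
have r0 k : (0 < (k.+1%:R^-1 / 2 : R))%R by rewrite divr_gt0.
pose C k i : set (borel S) :=
  h @^-1` closure (ball (h (s i)) (k.+1%:R^-1 / 2)).
have cC k i : closed (C k i).
  apply: preimage_closed; last exact: closed_closure.
  by move=> x _; exact: ch.
have mC k n : measurable (\big[setU/set0]_(i < n) C k i).
  by apply: bigsetU_measurable => i _; exact: closed_borel_measurable.
have C_h k i x : C k i x -> (mdist (h (s i)) (h x) <= k.+1%:R^-1)%R.
  move=> /(_ _ (nbhsx_ballx _ _ (r0 k)))[z [siz xz]].
  have := ball_triangle siz (ball_sym xz).
  by rewrite -splitr ballEmdist => /ltW.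
have Ccover k : \bigcap_n (~` \big[setU/set0]_(i < n) C k i) = set0.
  rewrite -subset0 => x Cx.
  have [||y [Oy Dy]] := dD (h @^-1` (ball (h x) (k.+1%:R^-1 / 2))^°).
  - by exists x; exact: nbhsx_ballx.
  - by apply: open_comp; [move=> ? _; exact: ch|exact: open_interior].
  have [i _ siy] := Ds _ Dy.
  apply: (Cx i.+1 I); rewrite big_ord_recr/=; right.
  apply: subset_closure; apply: ball_sym; rewrite siy.
  exact: (@interior_subset _ (ball (h x) _)).
have niC k : nonincreasing_seq (fun n => ~` \big[setU/set0]_(i < n) C k i).
  move=> m n mn; apply/subsetPset/subsetC; exact: subset_bigsetU.
have /choice[n mun] k : exists n,
    mu (~` \big[setU/set0]_(i < n) C k i) <= (e / (2 ^ k.+1)%:R)%:E.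
  apply: (nonincreasing_measure_small muoo) => //.
  - by move=> n; exact: measurableC.
  - by rewrite Ccover measure0.
  - by rewrite divr_gt0// ltr0n expn_gt0.
exists (\bigcap_k \big[setU/set0]_(i < n k) C k i).
  exact: (@compact_of_finite_nets R (borel S) M h g C n s).
rewrite setC_bigcap; apply: measure_bigcup_le_geometric => // k.
exact: measurableC.
Qed.

Lemma tight_sigma_compact (mu : {measure set (borel S) -> \bar R}) :
  polish R S -> mu [set: borel S] < +oo ->
  exists2 K : (set (borel S))^nat, forall n, compact (K n) &
    mu (~` \bigcup_n K n) = 0.
Proof.
move=> pS muoo.
have /choice[K KP] n : exists K : set (borel S),
    compact K /\ mu (~` K) <= (n.+1%:R^-1)%:E.
  by have [|K cK Ke] := ulam_tightness (e := n.+1%:R^-1) pS muoo => //; exists K.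
exists K => [n|]; first exact: (KP n).1.
have mK n : measurable (K n).
  apply: closed_borel_measurable; apply: compact_closed (KP n).1.
  exact: (completely_metrizable_hausdorff pS.2).
apply/eqP; rewrite eq_le measure_ge0 andbT.
apply/lee_addgt0Pr => e e0; rewrite add0e.
have [n _ /(_ n (leqnn _)) ne] := near_infty_natSinv_lt (PosNum e0).
apply: (@le_trans _ _ (mu (~` K n))).
  apply: le_measure; rewrite ?inE; last exact/subsetC/bigcup_sup.
  - by apply: measurableC; exact: bigcup_measurable.
  - exact: measurableC.
by apply: le_trans (KP n).2 _; rewrite lee_fin ltW.
Qed.

Definition outer_regular (mu : {measure set (borel S) -> \bar R}) :=
  forall E, measurable E ->
    mu E = ereal_inf [set mu U | U in [set U | open U /\ E `<=` U]].

(** The two-sided approximation, unlike outer regularity, is stable under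
    complements. *)
Let approximable (mu : {measure set (borel S) -> \bar R}) (E : set (borel S)) :=
  forall e : R, (0 < e)%R -> exists C U, [/\ closed C, open U, C `<=` E,
    E `<=` U & mu (U `\` C) <= e%:E].

(** [U] is the increasing union of the closed sets where a function vanishing
    exactly on its complement is at least [1 / (n + 1)]. *)
Lemma approximable_open (mu : {measure set (borel S) -> \bar R}) U :
  completely_metrizable R S -> mu [set: borel S] < +oo -> open U ->
  approximable mu U.
Proof.
move=> mS muoo oU e e0.
have [|d [cd d0 dU]] := closed_zero_set (A := ~` U) mS.
  exact: open_closedC.
pose C n : set (borel S) := [set x | (n.+1%:R^-1 <= d x)%R].
have cC n : closed (C n).
  rewrite (_ : C n = d @^-1` [set y | (n.+1%:R^-1 <= y)%R])//.
  by apply: preimage_closed; [move=> x _; exact: cd|exact: closed_ge].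
have CU n : C n `<=` U.
  move=> x; rewrite /C/= => nx; apply: contrapT => /dU dx.
  by move: nx; rewrite dx leNgt invr_gt0 ltr0n.
have mCn n := closed_borel_measurable (cC n).
have mU := open_borel_measurable oU.
have [||||n Cn] := @nonincreasing_measure_small _ _ mu (fun n => U `\` C n) e muoo.
- by move=> n; exact: measurableD.
- move=> m n mn; apply/subsetPset; apply: setDS => x; rewrite /C/=.
  by apply: le_trans; rewrite lef_pV2 ?posrE ?ltr0n// ler_nat.
- rewrite (_ : \bigcap_n _ = set0) ?measure0// -subset0 => x Cx.
  have [Ux _] := Cx 0%N I.
  have dx : (0 < d x)%R.
    by rewrite lt_neqAle d0 andbT eq_sym; apply/eqP => /dU; exact.
  have [n _ /(_ n (leqnn _)) ne] := near_infty_natSinv_lt (PosNum dx).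
  by have [_] := Cx n I; apply; exact: ltW.
- by [].
by exists (C n), U; split.
Qed.

(** For a countable union, the closed sets inside have a union that need not be
    closed; a finite subunion is, and it loses little mass since the measure is
    finite. *)
Lemma approximable_sigma_algebra (mu : {measure set (borel S) -> \bar R}) :
  mu [set: borel S] < +oo -> sigma_algebra setT (approximable mu).
Proof.
move=> muoo; split.
- move=> e e0; exists set0, set0; split=> //; rewrite ?setDv ?measure0 ?lee_fin ?ltW//.
  + exact: closed0.
  + exact: open0.
- move=> A AA e e0; have [C [U [cC oU CA AU UC]]] := AA e e0.
  exists (~` U), (~` C); rewrite setTD; split.
  + exact: open_closedC.
  + exact: closed_openC.
  + exact: subsetC.
  + exact: subsetC.
  + by rewrite setDE setCK setIC -setDE.
move=> F FA e e0.
have /choice[CU CUP] n : exists CU : set (borel S) * set (borel S),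
    [/\ closed CU.1, open CU.2, CU.1 `<=` F n, F n `<=` CU.2 &
      mu (CU.2 `\` CU.1) <= (e / 2 / (2 ^ n.+1)%:R)%:E].
  have [|C [U ?]] := FA n (e / 2 / (2 ^ n.+1)%:R)%R.
    by rewrite !divr_gt0// ltr0n expn_gt0.
  by exists (C, U).
pose C n := (CU n).1; pose U n := (CU n).2.
have mC n : measurable (C n).
  by have [? _ _ _ _] := CUP n; exact: closed_borel_measurable.
have mU n : measurable (U n).
  by have [_ ? _ _ _] := CUP n; exact: open_borel_measurable.
have mCn n : measurable (\big[setU/set0]_(i < n) C i).
  by apply: bigsetU_measurable => i _; exact: mC.
have mCoo : measurable (\bigcup_n C n) by exact: bigcup_measurable.
have mUoo : measurable (\bigcup_n U n) by exact: bigcup_measurable.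
have [||||n Cn] := @nonincreasing_measure_small _ _ mu
  (fun n => (\bigcup_n C n) `\` \big[setU/set0]_(i < n) C i) (e / 2) muoo.
- by move=> n; exact: measurableD.
- move=> m n mn; apply/subsetPset; apply: setDS; exact: subset_bigsetU.
- rewrite (_ : \bigcap_n _ = set0) ?measure0// -subset0 => x Cx.
  have [[i _ Cix] _] := Cx 0%N I; have [_] := Cx i.+1 I; apply.
  by rewrite big_ord_recr/=; right.
- by rewrite divr_gt0.
exists (\big[setU/set0]_(i < n) C i), (\bigcup_n U n); split.
- by apply: closed_bigsetU => i _; have [] := CUP i.
- by apply: bigcup_open => i _; have [] := CUP i.
- rewrite -bigcup_mkord => x [i _ Cix]; exists i => //.
  by have [_ _ + _ _] := CUP i; exact.
- by apply: subset_bigcup => i _; have [] := CUP i.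
apply: (@le_trans _ _ (mu ((\bigcup_i (U i `\` C i)) `|`
    ((\bigcup_n C n) `\` \big[setU/set0]_(i < n) C i)))).
  apply: le_measure; rewrite ?inE.
  - exact: measurableD.
  - apply: measurableU; last exact: measurableD.
    by apply: bigcup_measurable => i _; exact: measurableD.
  - move=> x [[i _ Uix] nCx].
    have [Cx|Cx] := pselect ((\bigcup_n C n) x); first by right.
    by left; exists i => //; split=> // Cix; apply: Cx; exists i.
apply: le_trans (measureU2 _ _ _) _.
- by apply: bigcup_measurable => i _; exact: measurableD.
- exact: measurableD.
rewrite [e in leRHS]splitr EFinD; apply: leeD => //.
apply: measure_bigcup_le_geometric => [|i|i].
- by rewrite divr_gt0.
- exact: measurableD.
- by have [] := CUP i.
Qed.

Lemma finite_outer_regular (mu : {measure set (borel S) -> \bar R}) :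
  completely_metrizable R S -> mu [set: borel S] < +oo -> outer_regular mu.
Proof.
move=> mS muoo E mE.
have : approximable mu E.
  move: E mE; apply: smallest_sub; first exact: approximable_sigma_algebra.
  by move=> U oU; exact: approximable_open.
move=> EA; apply/eqP; rewrite eq_le; apply/andP; split.
  apply: le_ereal_inf_tmp => _ [U [oU EU] <-].
  by apply: le_measure; rewrite ?inE//; exact: open_borel_measurable.
apply/lee_addgt0Pr => e e0.
have [C [U [cC oU CE EU UCe]]] := EA e e0.
apply: (@le_trans _ _ (mu U)); first by apply: ereal_inf_lbound; exists U.
have mC := closed_borel_measurable cC.
have mU := open_borel_measurable oU.
rewrite -(setDUK (subset_trans CE EU)) measureU//; last by rewrite setDIK.
- by apply: leeD => //; apply: le_measure; rewrite ?inE.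
- exact: measurableD.
Qed.

End finite_measures.

(** * Measures with a density *)

Lemma nondecreasing_cvg_le (R : realType) (u : nat -> R) (l : R) (k : nat) :
  nondecreasing_seq u -> u n @[n --> \oo] --> l -> (u k <= l)%R.
Proof.
move=> nd ul; have <- := cvg_lim (@Rhausdorff R) ul.
by apply: nondecreasing_cvgn_le => //; apply/cvg_ex; exists l.
Qed.

Lemma ge0_le_integral_EFin d (T : measurableType d) (R : realType)
    (mu : {measure set T -> \bar R}) (f g : T -> R) :
  measurable_fun setT f -> measurable_fun setT g ->
  (forall x, (0 <= f x <= g x)%R) ->
  \int[mu]_x (f x)%:E <= \int[mu]_x (g x)%:E.
Proof.
move=> mf mg fg; apply: ge0_le_integral => //.
- by move=> x _; rewrite lee_fin; have /andP[] := fg x.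
- exact/measurable_EFinP.
- exact/measurable_EFinP.
- by move=> x _; rewrite lee_fin; have /andP[] := fg x.
Qed.

Section densities.
Context d (T : measurableType d) (R : realType).
Import HBNNSimple.

(** The level set of [0] may have infinite measure. Cutting all level sets down
    to [E], off which [s] vanishes, keeps their measures finite when that of [E]
    is. *)
Lemma nnsfun_sum_indic (s : {nnsfun T >-> R}) (E : set T) :
  measurable E -> (forall x, ~ E x -> s x = 0%R) ->
  exists n (a : nat -> R) (A : nat -> set T),
    [/\ forall i, (0 <= a i)%R, forall i, measurable (A i),
        forall i, A i `<=` E &
        forall x, s x = (\sum_(i < n) a i * \1_(A i) x)%R].
Proof.
move=> mE sE; set r : seq R := finmap.enum_fset (fset_set (s @` setT)).
exists (size r), (fun i => r`_i)%R, (fun i => s @^-1` [set r`_i]%R `&` E).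
split=> [i|i|i|x].
- have [ir|ri] := ltnP i (size r); last by rewrite nth_default.
  have : r`_i%R \in r by exact: mem_nth.
  by rewrite in_fset_set// inE => -[x _ <-].
- exact: measurableI.
- by [].
have [Ex|nEx] := pselect (E x); last first.
  rewrite sE// big1// => i _; rewrite indicE memNset ?mulr0//.
  by move=> [].
rewrite fimfunEord -/r; apply: eq_bigr => i _; rewrite !indicE.
congr (_ * _%:R)%R.
by rewrite in_setI (mem_set Ex) andbT.
Qed.

Variables (nu mu : {measure set T -> \bar R}) (f : T -> R).
Hypotheses (mf : measurable_fun setT f) (f0 : forall x, (0 <= f x)%R).
Hypothesis muE : forall A, measurable A -> mu A = \int[nu]_(x in A) (f x)%:E.

(** Used both for [f_n dnu], with [nu] any measure, and for restrictions, whose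
    density is an indicator. *)
Lemma ge0_integral_density (g : T -> R) : measurable_fun setT g ->
  (forall x, (0 <= g x)%R) ->
  \int[mu]_x (g x)%:E = \int[nu]_x (g x * f x)%:E.
Proof.
move=> mg g0.
have mg' : measurable_fun setT (EFin \o g) by exact/measurable_EFinP.
pose h := nnsfun_approx measurableT mg'.
have hg x : (h n x)%:E @[n --> \oo] --> (g x)%:E.
  apply: (@cvg_nnsfun_approx _ _ _ _ measurableT (EFin \o g)) => // y _.
  by rewrite lee_fin.
have hnd x : nondecreasing_seq (h ^~ x).
  by move=> m n mn; exact/lefP/nd_nnsfun_approx.
transitivity (limn (fun n => \int[mu]_x (h n x)%:E)).
  rewrite -monotone_convergence//.
  - by apply: eq_integral => x _; apply/esym/cvg_lim => //; exact: hg.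
  - by move=> n; apply/measurable_EFinP; exact/measurable_funP.
  - by move=> n x _; rewrite lee_fin.
  - by move=> x _ m n mn; rewrite lee_fin hnd.
transitivity (limn (fun n => \int[nu]_x (h n x * f x)%:E)); last first.
  rewrite -monotone_convergence//.
  - apply: eq_integral => x _; apply/cvg_lim => //.
    under eq_fun do rewrite EFinM.
    by rewrite EFinM; apply: cvgeZr => //; exact: hg.
  - by move=> n; apply/measurable_EFinP; apply: measurable_funM.
  - by move=> n x _; rewrite lee_fin mulr_ge0.
  - by move=> x _ m n mn; rewrite lee_fin ler_wpM2r// hnd.
congr (limn _); apply/funext => n.
have [m [a [A [a0 mA _ hE]]]] := @nnsfun_sum_indic (h n) setT measurableT
  (fun x nx => False_ind _ (nx I)).
under eq_integral do rewrite hE -sumEFin.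
under [RHS]eq_integral do rewrite hE mulr_suml -sumEFin.
rewrite !ge0_integral_sum//.
- apply: eq_bigr => i _.
  under eq_integral do rewrite EFinM.
  under [RHS]eq_integral do rewrite -mulrA EFinM.
  rewrite !ge0_integralZl//.
  + rewrite integral_indic// setIT muE// integral_mkcond.
    congr (_ * _); apply: eq_integral => x _.
    by rewrite patchE indicE; case: ifPn => _; rewrite ?mul1r ?mul0r.
  + by apply/measurable_EFinP; exact: measurable_funM.
  + by move=> x _; rewrite lee_fin mulr_ge0.
  + by rewrite lee_fin.
  + exact/measurable_EFinP.
  + by rewrite lee_fin.
- by move=> i; apply/measurable_EFinP; do 2 apply: measurable_funM => //.
- by move=> i x _; rewrite lee_fin !mulr_ge0.
- by move=> i; apply/measurable_EFinP; exact: measurable_funM.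
- by move=> i x _; rewrite lee_fin mulr_ge0.
Qed.

End densities.

(** * From continuous to Borel test functions *)

Section transfer.
Variables (R : realType) (S : ptopologicalType).
Variables (m nu : {measure set (borel S) -> \bar R}).
Import HBNNSimple.

(** [psi] is a lower semicontinuous majorant of [phi], presented as an increasing
    limit of continuous functions. The bound [A] is to be independent of [e], as
    the excess of [Psi psi] over [Psi phi] then has integral at most
    [Psi A * e]. *)
Definition envelope (phi : borel S -> R) (A e : R) :=
  exists (g : nat -> borel S -> R) (psi : borel S -> R) (N : set (borel S)),
    [/\ [/\ forall k, continuous (g k), forall k x, (0 <= g k x)%R,
            forall x, nondecreasing_seq (g ^~ x) &
            forall x, g k x @[k --> \oo] --> psi x],
        forall x, (psi x <= A)%R, forall x, (phi x <= psi x)%R &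
        [/\ measurable N, nu N <= e%:E & forall x, ~ N x -> psi x = phi x]].

Lemma envelope0 (e : R) : (0 <= e)%R -> envelope (fun=> 0%R) 0 e.
Proof.
move=> e0; exists (fun _ _ => 0%R), (fun=> 0%R), set0; split=> //.
- by split=> [k x|k x|x i j _|x] //; exact: cvg_cst.
- by split=> //; rewrite measure0 lee_fin.
Qed.

Lemma envelopeD (phi1 phi2 : borel S -> R) (A1 A2 e1 e2 : R) :
  envelope phi1 A1 e1 -> envelope phi2 A2 e2 ->
  envelope (fun x => phi1 x + phi2 x)%R (A1 + A2) (e1 + e2).
Proof.
move=> [g1 [p1 [N1 [[cg1 g10 nd1 gp1] pA1 pp1 [mN1 N1e N1p]]]]].
move=> [g2 [p2 [N2 [[cg2 g20 nd2 gp2] pA2 pp2 [mN2 N2e N2p]]]]].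
exists (fun k x => g1 k x + g2 k x)%R, (fun x => p1 x + p2 x)%R, (N1 `|` N2).
split.
- split=> [k x|k x|x i j ij|x].
  + by apply: cvgD; [exact: cg1|exact: cg2].
  + by rewrite addr_ge0.
  + by apply: lerD; [exact: nd1|exact: nd2].
  + by apply: cvgD; [exact: gp1|exact: gp2].
- by move=> x; exact: lerD.
- by move=> x; exact: lerD.
split.
- exact: measurableU.
- by rewrite EFinD; apply: le_trans (measureU2 _ _ _) _ => //; exact: leeD.
- by move=> x /not_orP[nN1 nN2]; rewrite N1p// N2p.
Qed.

(** The envelope is [a 1_U] for an open set [U] containing [E] with
    [nu(U \ E) <= e]; this is where outer regularity enters. *)
Lemma envelope_indic (E : set (borel S)) (a e : R) :
  completely_metrizable R S -> outer_regular nu -> measurable E ->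
  nu E < +oo -> (0 <= a)%R -> (0 < e)%R ->
  envelope (fun x => a * \1_E x)%R a e.
Proof.
move=> mS nureg mE Eoo a0 e0.
have Efin : nu E \is a fin_num by rewrite ge0_fin_numE.
have : nu E < nu E + e%:E by rewrite lteDl// lte_fin.
rewrite {1}nureg// => /ereal_inf_lt[_ [U [oU EU] <-] Ue].
have mU := open_borel_measurable oU.
have [u [cu u0 ndu ulim]] := open_indic_sup mS oU.
have u1 (x : borel S) : (\1_U x <= 1 :> R)%R by rewrite indicE lern1 leq_b1.
exists (fun k x => a * u k x)%R, (fun x => a * \1_U x)%R, (U `\` E); split.
- split=> [k x|k x|x i j ij|x].
  + by apply: cvgMr; exact: cu.
  + by rewrite mulr_ge0.
  + by rewrite ler_wpM2l// ndu.
  + by apply: cvgMr; exact: ulim.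
- by move=> x; rewrite -[leRHS]mulr1 ler_wpM2l.
- move=> x; rewrite ler_wpM2l// !indicE ler_nat.
  by have [/set_mem/EU Ux|//] := boolP (x \in E); rewrite mem_set.
split.
- exact: measurableD.
- rewrite measureD//; last by apply: lt_le_trans Ue _; rewrite leey.
  by rewrite setIidr// leeBlDl// ltW.
- move=> x UEx; rewrite !indicE; have [Ex|nEx] := pselect (E x).
    by rewrite !mem_set//; exact: EU.
  by rewrite !memNset// => Ux; apply: UEx.
Qed.

Lemma envelope_nnsfun (s : {nnsfun (borel S) >-> R}) (E : set (borel S)) :
  completely_metrizable R S -> outer_regular nu -> measurable E ->
  nu E < +oo -> (forall x, ~ E x -> s x = 0%R) ->
  exists2 A : R, (0 <= A)%R & forall e : R, (0 < e)%R -> envelope s A e.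
Proof.
move=> mS nureg mE Eoo sE.
have [n [a [B [a0 mB BE sB]]]] := nnsfun_sum_indic mE sE.
exists (\sum_(i < n) a i)%R; first exact: sumr_ge0.
rewrite (_ : (s : _ -> _) = fun x => (\sum_(i < n) a i * \1_(B i) x)%R);
  last exact/funext.
elim: n {sB} => [|n IH] e e0.
  rewrite big_ord0 (_ : (fun _ => _) = fun=> 0%R).
    exact: envelope0 (ltW e0).
  by apply/funext => x; rewrite big_ord0.
rewrite big_ord_recr/= [e]splitr.
rewrite (_ : (fun _ => _) =
    fun x => (\sum_(i < n) a i * \1_(B i) x + a n * \1_(B n) x)%R); last first.
  by apply/funext => x; rewrite big_ord_recr.
apply: envelopeD; first by apply: IH; rewrite divr_gt0.
apply: envelope_indic => //; last by rewrite divr_gt0.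
by apply: le_lt_trans Eoo; apply: le_measure; rewrite ?inE.
Qed.

Variables (Psi : R -> R) (C : \bar R).
Hypotheses (mPsi : measurable_fun setT Psi)
  (Psi0 : forall t, (0 <= t)%R -> (0 <= Psi t)%R)
  (ndPsi : forall s t, (0 <= s <= t)%R -> (Psi s <= Psi t)%R).
Hypotheses (mS : completely_metrizable R S) (nureg : outer_regular nu).
Hypothesis cont_bound : forall g : borel S -> R, continuous g -> bounded_fun g ->
  (forall x, (0 <= g x)%R) ->
  \int[m]_x (g x)%:E <= C + \int[nu]_x (Psi (g x))%:E.

Let mPsi_comp (g : borel S -> R) : measurable_fun setT g ->
  measurable_fun setT (fun x => Psi (g x)).
Proof. by move=> mg; exact: measurableT_comp. Qed.

(** The hypothesis holds for the continuous functions below the envelope [psi],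
    hence for [psi] by monotone convergence on the left-hand side; then [psi] is
    compared with [s]. *)
Lemma nnsfun_bound_transfer (s : {nnsfun (borel S) >-> R}) (E : set (borel S)) :
  measurable E -> nu E < +oo -> (forall x, ~ E x -> s x = 0%R) ->
  \int[m]_x (s x)%:E <= C + \int[nu]_x (Psi (s x))%:E.
Proof.
move=> mE Eoo sE; have [A A0 sA] := envelope_nnsfun mS nureg mE Eoo sE.
apply/lee_addgt0Pr => e e0.
(* The summand 1 guards against Psi A = 0. *)
have e'0 : (0 < e / (Psi A + 1))%R.
  by rewrite divr_gt0// ltr_wpDl// Psi0.
have [g [p [N [[cg g0 nd gp] pA sp [mN Ne Np]]]]] := sA _ e'0.
have mg k : measurable_fun setT (g k).
  exact: continuous_borel_measurable.
have p0 x : (0 <= p x)%R by apply: le_trans (sp x).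
have gp' x k : (g k x <= p x)%R.
  exact: nondecreasing_cvg_le (nd x) (gp x).
have mp : measurable_fun setT p.
  by apply: (measurable_fun_cvg mg) => x _; exact: gp.
have int_gp : \int[m]_x (g k x)%:E @[k --> \oo] --> \int[m]_x (p x)%:E.
  rewrite (eq_integral (fun x => limn (fun k => (g k x)%:E))); last first.
    move=> x _; apply/esym/cvg_lim => //.
    by apply/fine_cvgP; split; [exact: nearW|exact: gp].
  apply: cvg_monotone_convergence => //.
  - by move=> k; exact/measurable_EFinP.
  - by move=> k x _; rewrite lee_fin.
  - by move=> x _ i j ij; rewrite lee_fin nd.
have le1 : \int[m]_x (s x)%:E <= \int[m]_x (p x)%:E.
  by apply: ge0_le_integral_EFin => // x; apply/andP.
have le2 : \int[m]_x (p x)%:E <= C + \int[nu]_x (Psi (p x))%:E.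
  have <- := cvg_lim (@ereal_hausdorff R) int_gp.
  apply: lime_le; first by apply/cvg_ex; eexists; exact: int_gp.
  apply: nearW => k; apply: le_trans (cont_bound (cg k) _ (g0 k)) _.
    exists A; split; first exact: num_real.
    move=> B AB x _ /=; rewrite ger0_norm//; apply: le_trans (gp' x k) _.
    by apply: le_trans (pA x) _; exact: ltW.
  apply: leeD2l; apply: ge0_le_integral_EFin.
  - exact: mPsi_comp.
  - exact: mPsi_comp.
  - by move=> x; rewrite Psi0// ndPsi// g0 gp'.
apply: le_trans le1 _; apply: le_trans le2 _; rewrite -addeA; apply: leeD2l.
apply: (@le_trans _ _ (\int[nu]_x ((Psi (s x))%:E + (Psi A * \1_N x)%:E))).
  under [leRHS]eq_integral do rewrite -EFinD.
  apply: ge0_le_integral_EFin.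
  - exact: mPsi_comp.
  - by apply: measurable_funD; [exact: mPsi_comp|exact: measurable_funM].
  - move=> x; rewrite Psi0//=; have [Nx|nNx] := pselect (N x).
      rewrite indicE mem_set// mulr1 -[leLHS]add0r lerD ?Psi0//.
      by rewrite ndPsi// p0 pA.
    by rewrite Np// lerDl mulr_ge0 ?Psi0.
rewrite ge0_integralD//.
- apply: leeD2l; under eq_integral do rewrite EFinM.
  rewrite ge0_integralZl// ?integral_indic ?setIT//.
  + apply: (@le_trans _ _ ((Psi A)%:E * (e / (Psi A + 1))%:E)).
      by apply: lee_wpmul2l => //; rewrite lee_fin Psi0.
    rewrite -EFinM lee_fin mulrA ler_pdivrMr ?ltr_wpDl ?Psi0//.
    by rewrite mulrC ler_wpM2l ?ltW// ltrDl.
  + exact/measurable_EFinP.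
  + by rewrite lee_fin Psi0.
- by move=> x _; rewrite lee_fin Psi0.
- by apply/measurable_EFinP; exact: mPsi_comp.
- by move=> x _; rewrite lee_fin mulr_ge0 ?Psi0.
- exact/measurable_EFinP/measurable_funM.
Qed.

(** Simple functions increase to [phi]; on the right-hand side the monotonicity
    of [Psi] bounds their integrals by that of [Psi phi]. *)
Lemma integral_bound_transfer (phi : borel S -> R) (E : set (borel S)) :
  measurable_fun setT phi -> (forall x, (0 <= phi x)%R) ->
  measurable E -> nu E < +oo -> (forall x, ~ E x -> phi x = 0%R) ->
  \int[m]_x (phi x)%:E <= C + \int[nu]_x (Psi (phi x))%:E.
Proof.
move=> mphi phi0 mE Eoo phiE.
have mphi' : measurable_fun setT (EFin \o phi) by exact/measurable_EFinP.
pose h := nnsfun_approx measurableT mphi'.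
have hphi x : (h n x)%:E @[n --> \oo] --> (phi x)%:E.
  apply: (@cvg_nnsfun_approx _ _ _ _ measurableT (EFin \o phi)) => // y _.
  by rewrite lee_fin.
have hnd x : nondecreasing_seq (h ^~ x).
  by move=> i n mn; exact/lefP/nd_nnsfun_approx.
have hle n x : (h n x <= phi x)%R.
  by have /fine_cvgP[_ /nondecreasing_cvg_le] := hphi x; apply; exact: hnd.
have -> : \int[m]_x (phi x)%:E = limn (fun n => \int[m]_x (h n x)%:E).
  rewrite -monotone_convergence//.
  - by apply: eq_integral => x _; apply/esym/cvg_lim => //; exact: hphi.
  - by move=> n; apply/measurable_EFinP; exact/measurable_funP.
  - by move=> n x _; rewrite lee_fin.
  - by move=> x _ i n mn; rewrite lee_fin hnd.
apply: lime_le.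
  apply: ereal_nondecreasing_is_cvgn => i j ij.
  by apply: ge0_le_integral_EFin => // x; apply/andP; split=> //; exact: hnd.
apply: nearW => n; apply: le_trans (nnsfun_bound_transfer mE Eoo _) _.
  by move=> x /phiE phix; apply/le_anti/andP; split=> //; rewrite -phix.
apply: leeD2l; apply: ge0_le_integral_EFin => [||x].
- exact: mPsi_comp.
- exact: mPsi_comp.
- by rewrite Psi0// ndPsi// hle andbT.
Qed.

End transfer.

(** * Young's inequality as a characterization of the norm *)

Section young_duality.
Context d (T : measurableType d) (R : realType).
Variable nu : {measure set T -> \bar R}.

Lemma Lnorm_EFinE (r : R) (f : T -> R) :
  'N[nu]_r%:E[EFin \o f] = (\int[nu]_x (`|f x| `^ r)%:E) `^ r^-1.
Proof.
by rewrite unlock; congr (_ `^ _); apply: eq_integral.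
Qed.

Lemma Lnorm_leP (r M : R) (f : T -> R) : (0 < r)%R -> (0 <= M)%R ->
  'N[nu]_r%:E[EFin \o f] <= M%:E <->
  \int[nu]_x (`|f x| `^ r)%:E <= (M `^ r)%:E.
Proof.
move=> r0 M0.
have E : \int[nu]_x (`|f x| `^ r)%:E = 'N[nu]_r%:E[EFin \o f] `^ r.
  by rewrite poweR_Lnorm ?gt_eqF//; apply: eq_integral => x _ /=; rewrite poweR_EFin.
have I0 : 0 <= \int[nu]_x (`|f x| `^ r)%:E.
  by apply: integral_ge0 => x _; rewrite lee_fin powR_ge0.
split=> [NM|IM].
  rewrite E -poweR_EFin; apply: gt0_ler_poweR => //; first exact: ltW.
  - by rewrite in_itv/= Lnorm_ge0 leey.
  - by rewrite in_itv/= lee_fin M0 leey.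
rewrite Lnorm_EFinE; have -> : M = ((M `^ r) `^ r^-1)%R.
  by rewrite -powRrM divff ?gt_eqF// powRr1.
rewrite -poweR_EFin; apply: gt0_ler_poweR => //; first by rewrite invr_ge0 ltW.
- by rewrite in_itv/= I0 leey.
- by rewrite in_itv/= lee_fin powR_ge0 leey.
Qed.

(** [young_cst] and [young_fun] are the constant [C] and the function [Psi] for
    which [int g |f| <= C + int Psi(g)] for all [g >= 0] expresses that the
    [L^p] norm of [f] is at most [M]. For finite [p], [young_fun] is [t^q / q]
    with [q = p / (p - 1)] the conjugate exponent. *)
Definition young_fun (p : \bar R) (M t : R) : R :=
  match p with
  | r%:E => t `^ (r / (r - 1)) / (r / (r - 1))
  | _ => M * t
  end%R.

Definition young_cst (p : \bar R) (M : R) : \bar R :=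
  match p with r%:E => (M `^ r / r)%:E | _ => 0 end.

Section young_fun_theory.
Variables (p : \bar R) (M : R).
Hypotheses (p1 : 1 < p) (M0 : (0 <= M)%R).

Let conj_gt0 (r : R) : (1 < r -> 0 < r / (r - 1))%R.
Proof. by move=> r1; rewrite divr_gt0 ?subr_gt0// (lt_trans ltr01). Qed.

Lemma measurable_young_fun : measurable_fun setT (young_fun p M).
Proof.
by case: p => [r||] /=; apply: measurable_funM.
Qed.

Lemma young_cst_ge0 : 0 <= young_cst p M.
Proof.
case: p p1 => [r|//|//] /=; rewrite lte_fin lee_fin => r1.
by rewrite divr_ge0 ?powR_ge0// ltW// (lt_trans ltr01).
Qed.

Lemma young_cst_fin_num : young_cst p M \is a fin_num.
Proof. by case: p. Qed.

Lemma young_fun_ge0 (t : R) : (0 <= t)%R -> (0 <= young_fun p M t)%R.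
Proof.
move=> t0; case: p p1 => [r|_|//] /=; last exact: mulr_ge0.
rewrite lte_fin => r1; rewrite mulr_ge0 ?powR_ge0// invr_ge0 ltW//.
exact: conj_gt0.
Qed.

Lemma young_fun_nondecreasing (s t : R) :
  (0 <= s <= t)%R -> (young_fun p M s <= young_fun p M t)%R.
Proof.
move=> /andP[s0 st]; case: p p1 => [r|_|//] /=; last exact: ler_wpM2l.
rewrite lte_fin => /conj_gt0 q0; rewrite ler_wpM2r ?invr_ge0 ?(ltW q0)//.
by apply: ge0_ler_powR; rewrite ?nnegrE ?(ltW q0)// (le_trans s0).
Qed.

Lemma young_fun0 : young_fun p M 0 = 0%R.
Proof.
case: p p1 => [r|_|//] /=; last by rewrite mulr0.
by rewrite lte_fin => /conj_gt0 q0; rewrite powR0 ?mul0r// gt_eqF.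
Qed.

Lemma young_integral_le (f g : T -> R) :
  measurable_fun setT f -> measurable_fun setT g -> (forall x, (0 <= g x)%R) ->
  'N[nu]_p[EFin \o f] <= M%:E ->
  \int[nu]_x (g x * `|f x|)%:E <=
    young_cst p M + \int[nu]_x (young_fun p M (g x))%:E.
Proof.
move=> mf mg g0; have mnf : measurable_fun setT (fun x => `|f x|%R).
  exact: measurableT_comp.
case: p p1 => [r|_|//]; last first.
  rewrite /young_cst /young_fun add0e => Nf.
  have fM : \forall x \ae nu, (`|f x| <= M)%R.
    (* The norm is 0 by definition when nu vanishes. *)
    have [nuT|] := ltP 0 (nu setT); last first.
      move=> nuT; exists setT; split=> //.
      by apply/eqP; rewrite eq_le nuT measure_ge0.
    move: Nf; rewrite unlock nuT => /ess_supP.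
    by apply: filterS => x /=; rewrite lee_fin.
  apply: ae_ge0_le_integral => //.
  - by move=> x _; rewrite lee_fin mulr_ge0.
  - by apply/measurable_EFinP; exact: measurable_funM.
  - by move=> x _; rewrite lee_fin mulr_ge0.
  - by apply/measurable_EFinP; exact: measurable_funM.
  - by apply: filterS fM => x fM _; rewrite lee_fin mulrC ler_wpM2r.
rewrite lte_fin => r1 Nf; have q0 := conj_gt0 r1.
have r0 : (0 < r)%R by rewrite (lt_trans ltr01).
rewrite /young_cst /young_fun; set q := (r / (r - 1))%R.
have rq : (r^-1 + q^-1 = 1)%R.
  by rewrite /q invf_div mulrBl divff ?gt_eqF// mul1r addrC subrK.
apply: (@le_trans _ _ (\int[nu]_x ((`|f x| `^ r / r)%:E + (g x `^ q / q)%:E))).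
  under [leRHS]eq_integral do rewrite -EFinD.
  apply: ge0_le_integral_EFin.
  - exact: measurable_funM.
  - apply: measurable_funD; apply: measurable_funM => //;
      exact: (measurableT_comp (measurable_powR _)).
  - by move=> x; rewrite mulr_ge0//= mulrC conjugate_powR.
rewrite ge0_integralD//.
- apply: leeD2r; under eq_integral do rewrite mulrC EFinM.
  rewrite ge0_integralZl//; last by rewrite lee_fin invr_ge0 ltW.
    rewrite mulrC EFinM; apply: lee_wpmul2l; first by rewrite lee_fin invr_ge0 ltW.
    exact/Lnorm_leP.
  exact/measurable_EFinP/(measurableT_comp (measurable_powR _)).
- by move=> x _; rewrite lee_fin divr_ge0 ?powR_ge0 ?ltW.
- apply/measurable_EFinP; apply: measurable_funM => //.
  exact: (measurableT_comp (measurable_powR _)).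
- by move=> x _; rewrite lee_fin divr_ge0 ?powR_ge0 ?ltW.
- apply/measurable_EFinP; apply: measurable_funM => //.
  exact: (measurableT_comp (measurable_powR _)).
Qed.

Variables (f : T -> R) (F : (set T)^nat).
Hypotheses (mf : measurable_fun setT f) (f0 : forall x, (0 <= f x)%R)
  (mF : forall k, measurable (F k)) (ndF : nondecreasing_seq F)
  (Foo : forall k, nu (F k) < +oo)
  (fF : forall x, ~ (\bigcup_k F k) x -> f x = 0%R).
Hypothesis dual : forall (phi : T -> R) k, measurable_fun setT phi ->
  (forall x, (0 <= phi x)%R) -> (forall x, ~ F k x -> phi x = 0%R) ->
  \int[nu]_x (phi x * f x)%:E <=
    young_cst p M + \int[nu]_x (young_fun p M (phi x))%:E.

(** The test function is [h^(r-1)], [h] being [f] truncated at height [k] and to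
    [F k], for which Young's inequality is an equality. The truncation makes
    [int h^r] finite, so that it can be absorbed into the left-hand side. *)
Lemma Lnorm_le_of_young_fin (r : R) : p = r%:E -> 'N[nu]_p[EFin \o f] <= M%:E.
Proof.
move=> pr; move: p1 dual; rewrite pr lte_fin => r1; have q0 := conj_gt0 r1.
have r0 : (0 < r)%R by rewrite (lt_trans ltr01).
have r10 : (0 < r - 1)%R by rewrite subr_gt0.
rewrite /young_cst /young_fun; set q := (r / (r - 1))%R => dualr.
pose h (k : nat) x := (Num.min (f x) k%:R * \1_(F k) x)%R.
have h0 k x : (0 <= h k x)%R by rewrite mulr_ge0// le_min f0/=.
have hf k x : (h k x <= f x)%R.
  rewrite /h indicE; case: (x \in F k); rewrite ?mulr1 ?mulr0//.
  by rewrite ge_min lexx.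
have hk k x : (h k x <= k%:R * \1_(F k) x)%R.
  by rewrite ler_wpM2r// ge_min lexx orbT.
have mh k : measurable_fun setT (h k).
  by apply: measurable_funM => //; exact: measurable_minr.
have mhr k s : measurable_fun setT (fun x => h k x `^ s)%R.
  exact: (measurableT_comp (measurable_powR _)).
have h_out k x : ~ F k x -> h k x = 0%R.
  by move=> nFx; rewrite /h indicE memNset// mulr0.
have hrE k x : (h k x `^ r = h k x `^ (r - 1) * h k x)%R.
  by rewrite mulrC mulr_powRB1.
have Ioo k : \int[nu]_x (h k x `^ r)%:E \is a fin_num.
  rewrite ge0_fin_numE; last by apply: integral_ge0 => x _; rewrite lee_fin powR_ge0.
  apply: (@le_lt_trans _ _ (\int[nu]_x (k%:R `^ r * \1_(F k) x)%:E)).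
    apply: ge0_le_integral_EFin => // [|x]; first exact: measurable_funM.
    rewrite powR_ge0/=; have [Fx|nFx] := pselect (F k x).
      rewrite indicE mem_set// mulr1; apply: ge0_ler_powR; rewrite ?nnegrE ?(ltW r0)//.
      by apply: le_trans (hk k x) _; rewrite indicE mem_set// mulr1.
    by rewrite h_out// powR0 ?gt_eqF// mulr_ge0// powR_ge0.
  under eq_integral do rewrite EFinM.
  rewrite ge0_integralZl ?lee_fin ?powR_ge0//; last exact/measurable_EFinP.
  by rewrite integral_indic// setIT lte_mul_pinfty ?lee_fin ?powR_ge0.
have IM k : \int[nu]_x (h k x `^ r)%:E <= (M `^ r)%:E.
  have psiE : \int[nu]_x (h k x `^ (r - 1) `^ q / q)%:E =
      (q^-1)%:E * \int[nu]_x (h k x `^ r)%:E.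
    rewrite -ge0_integralZl//.
    - apply: eq_integral => x _; rewrite -powRrM -EFinM mulrC /q mulrCA.
      by rewrite divff ?mulr1// gt_eqF.
    - exact/measurable_EFinP.
    - by move=> x _; rewrite lee_fin powR_ge0.
    - by rewrite lee_fin invr_ge0 ltW.
  have le1 : \int[nu]_x (h k x `^ r)%:E <=
      \int[nu]_x (h k x `^ (r - 1) * f x)%:E.
    apply: ge0_le_integral_EFin => // [|x]; first exact: measurable_funM.
    by rewrite powR_ge0/= hrE ler_wpM2l ?powR_ge0.
  have hr_out x : ~ F k x -> (h k x `^ (r - 1) = 0)%R.
    by move=> /h_out ->; rewrite powR0// gt_eqF.
  have := le_trans le1 (dualr _ k (mhr k _) (fun x => powR_ge0 _ _) hr_out).
  rewrite psiE -(fineK (Ioo k)) -EFinM -EFinD !lee_fin.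
  rewrite -lerBlDr -[X in (X - _)%R]mul1r -mulrBl.
  have -> : (1 - q^-1 = r^-1)%R.
    by rewrite /q invf_div mulrBl divff ?gt_eqF// mul1r opprB addrC subrK.
  by rewrite mulrC ler_pM2r// invr_gt0.
have hnear x : \forall k \near \oo, h k x = f x.
  have [[j _ Fx]|nFx] := pselect ((\bigcup_k F k) x); last first.
    by apply: nearW => k; rewrite fF// h_out// => Fx; apply: nFx; exists k.
  near=> k.
  have Fkx : F k x.
    have /subsetPset : (F j <= F k)%O.
      by apply: ndF; near: k; exact: nbhs_infty_ge.
    exact.
  rewrite /h indicE mem_set// mulr1; apply/min_idPl.
  near: k; exact: nbhs_infty_ger.
have hnd x : nondecreasing_seq (h ^~ x).
  move=> i j ij; apply: ler_pM => //; first by rewrite le_min f0/=.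
    by rewrite le_min !ge_min lexx/= ler_nat ij orbT.
  rewrite !indicE ler_nat; have [/set_mem Fix|//] := boolP (x \in F i).
  by rewrite mem_set//; have /subsetPset := ndF ij; exact.
apply/Lnorm_leP => //.
have -> : \int[nu]_x (`|f x| `^ r)%:E = limn (fun k => \int[nu]_x (h k x `^ r)%:E).
  rewrite -monotone_convergence//.
  - apply: eq_integral => x _; apply/esym/cvg_lim => //; apply: cvg_near_cst.
    by apply: filterS (hnear x) => k ->; rewrite ger0_norm.
  - by move=> k; exact/measurable_EFinP.
  - by move=> k x _; rewrite lee_fin powR_ge0.
  - move=> x _ i j ij; rewrite lee_fin; apply: ge0_ler_powR; rewrite ?nnegrE ?(ltW r0)//.
    exact: hnd.
apply: lime_le; last exact: nearW.
apply: ereal_nondecreasing_is_cvgn => i j ij; apply: ge0_le_integral_EFin => // x.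
rewrite powR_ge0/=; apply: ge0_ler_powR; rewrite ?nnegrE ?(ltW r0)//.
exact: hnd.
Unshelve. all: by end_near. Qed.

(** Testing with the indicator of the part of [F k] where [f > M] shows that
    this set is negligible. *)
Lemma Lnorm_le_of_young_infty : p = +oo -> 'N[nu]_p[EFin \o f] <= M%:E.
Proof.
move=> py; move: dual; rewrite py /young_cst /young_fun => dualy.
pose E k := F k `&` [set x | (M < f x)%R].
have mE k : measurable (E k).
  apply: measurableI => //; rewrite -[X in measurable X]setTI.
  by rewrite -[X in _ `&` X](_ : f @^-1` `]M, +oo[ = _);
    [exact: mf|apply/seteqP; split=> x /=; rewrite in_itv/= andbT].
have E0 k : nu (E k) = 0.
  have mg : measurable_fun setT (fun x => \1_(E k) x * (f x - M))%R.
    by apply: measurable_funM => //; exact: measurable_funB.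
  have g0 x : (0 <= \1_(E k) x * (f x - M))%R.
    rewrite indicE; have [/set_mem[_ Mf]|_] := boolP (x \in E k); last by rewrite mul0r.
    by rewrite mul1r subr_ge0 ltW.
  have Ek_oo : nu (E k) < +oo.
    by apply: le_lt_trans (Foo k); apply: le_measure; rewrite ?inE//; exact: subIsetl.
  have m1 : measurable_fun setT (\1_(E k) : T -> R) by exact: measurable_indic.
  have := dualy (\1_(E k)) k m1 (ltac:(by move=> x; rewrite indicE)).
  have -> : \int[nu]_x (\1_(E k) x * f x)%:E =
      \int[nu]_x (\1_(E k) x * (f x - M))%:E + \int[nu]_x (M * \1_(E k) x)%:E.
    rewrite -ge0_integralD//.
    - by apply: eq_integral => x _; rewrite -EFinD; congr EFin; ring.
    - by move=> x _; rewrite lee_fin.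
    - exact/measurable_EFinP.
    - by move=> x _; rewrite lee_fin mulr_ge0.
    - by apply/measurable_EFinP; exact: measurable_funM.
  have -> : \int[nu]_x (M * \1_(E k) x)%:E = M%:E * nu (E k).
    under eq_integral do rewrite EFinM.
    by rewrite ge0_integralZl ?integral_indic ?setIT//; exact/measurable_EFinP.
  have MEfin : M%:E * nu (E k) \is a fin_num.
    by rewrite fin_numM// ge0_fin_numE.
  rewrite add0e -leeBrDr// subee// => le0.
  have {le0} : \int[nu]_x `|(\1_(E k) x * (f x - M))%:E| = 0.
    apply/eqP; rewrite eq_le integral_ge0// andbT.
    under eq_integral do rewrite gee0_abs ?lee_fin//.
    by apply: le0 => x nFx; rewrite indicE memNset// => -[].
  have mg' : measurable_fun setT (fun x => (\1_(E k) x * (f x - M))%:E).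
    exact/measurable_EFinP.
  move=> /(ae_eq_integral_abs nu measurableT mg')[N [mN N0 EN]].
  apply: (subset_measure0 (mE k) mN) => // x Ex; apply: EN => /(_ I)/eqP /=.
  rewrite indicE mem_set// mul1r eqe subr_eq0 => /eqP fxM.
  by have [_] := Ex; rewrite /= fxM ltxx.
have fM : \forall x \ae nu, (f x <= M)%R.
  have : nu.-negligible (\bigcup_k E k).
    by apply: negligible_bigcup => k; exists (E k); split => //; exact: E0.
  apply: negligibleS => x /= /negP; rewrite -ltNge => Mf.
  have [k _ Fx] : (\bigcup_k F k) x.
    by apply: contrapT => /fF fx0; move: Mf; rewrite fx0 ltNge M0.
  by exists k.
rewrite unlock; case: ifPn => // _; apply/ess_supP.
by apply: filterS fM => x /=; rewrite lee_fin ger0_norm.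
Qed.

Lemma Lnorm_le_of_young : 'N[nu]_p[EFin \o f] <= M%:E.
Proof.
have [|[r]] : p = +oo \/ exists r, p = r%:E.
- by case: p p1 => [r|_|//]; [right; exists r|left].
- exact: Lnorm_le_of_young_infty.
- exact: Lnorm_le_of_young_fin.
Qed.

End young_fun_theory.
End young_duality.

(** * Positive charges, their integrals and weak convergence *)

Section nonnegative_charges.
Context d (T : measurableType d) (R : realType).
Variable mu : {charge set T -> \bar R}.
Variables (P N : set T) (PN : hahn_decomposition mu P N).

Lemma jordan_posE_hahn (A : set T) : measurable A ->
  jordan_pos PN A = mu (A `&` P).
Proof.
by move=> mA; rewrite jordan_posE cjordan_posE /crestr0 mem_set.
Qed.

Lemma jordan_negE_hahn (A : set T) : measurable A ->
  jordan_neg PN A = - mu (A `&` N).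
Proof.
by move=> mA; rewrite jordan_negE cjordan_negE /crestr0 mem_set.
Qed.

Lemma jordan_pos_sub_neg (A : set T) : measurable A ->
  mu A = jordan_pos PN A - jordan_neg PN A.
Proof. by move=> mA; rewrite (jordan_decomp PN mA) /cadd/= cscaleN1. Qed.

Lemma jordan_neg_nonneg (A : set T) :
  (forall B, measurable B -> 0 <= mu B) -> measurable A -> jordan_neg PN A = 0.
Proof.
move=> mu0 mA; apply/eqP; rewrite eq_le measure_ge0 andbT.
rewrite jordan_negE_hahn// leeNl oppe0 mu0//.
by have [_ [mN _] _ _] := PN; exact: measurableI.
Qed.

Lemma jordan_pos_nonneg (A : set T) :
  (forall B, measurable B -> 0 <= mu B) -> measurable A -> jordan_pos PN A = mu A.
Proof.
by move=> mu0 mA; rewrite jordan_pos_sub_neg// jordan_neg_nonneg// sube0.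
Qed.

Lemma jordan_pos_hahn_neg : jordan_pos PN N = 0.
Proof.
have [_ [mN _] _ PN0] := PN.
by rewrite jordan_posE_hahn// setIC PN0 charge0.
Qed.

End nonnegative_charges.

Section density_integral.
Context d (T : measurableType d) (R : realType).

Lemma bounded_measurable_integrable (mu : {measure set T -> \bar R}) (g : T -> R) :
  mu setT < +oo -> measurable_fun setT g -> bounded_fun g ->
  mu.-integrable setT (EFin \o g).
Proof.
move=> muoo mg [B [_ gB]]; apply: measurable_bounded_integrable => //.
exists B; split; first exact: num_real.
by move=> x Bx y _; exact: gB.
Qed.

Lemma charge_integral_nonneg (mu : {charge set T -> \bar R}) (g : T -> R) :
  (forall B, measurable B -> 0 <= mu B) ->
  measurable_fun setT g -> bounded_fun g ->
  (charge_integral mu g)%:E = \int[jordan_pos (hahnP mu)]_x (g x)%:E.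
Proof.
move=> mu0 mg bg.
have Ineg : \int[jordan_neg (hahnP mu)]_x (g x)%:E = 0.
  rewrite (eq_measure_integral mzero) ?integral_measure_zero// => A mA _.
  exact: jordan_neg_nonneg.
rewrite /charge_integral /Rintegral Ineg subr0 fineK//.
apply: integrable_fin_num => //; apply: bounded_measurable_integrable => //.
by rewrite ltey_eq fin_num_measure.
Qed.

Variables (nu : {measure set T -> \bar R}) (p : \bar R) (f : T -> R).
Hypothesis fp : Lp_plus nu p f.

Lemma Lp_plus_measurable : measurable_fun setT f.
Proof. by have [/andP[/[!inE]]] := fp. Qed.

(** The absolute value gives a density that is nonnegative everywhere and not
    merely almost everywhere. *)
Lemma density_abs (A : set T) : measurable A ->
  density fp A = \int[nu]_(x in A) `|f x|%:E.
Proof.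
move=> mA; have mf := Lp_plus_measurable; have [_ _ f0] := fp.
rewrite /density/= /induced_charge; apply: ae_eq_integral => //.
- by apply/measurable_EFinP; exact: measurable_funTS.
- by apply/measurable_EFinP; apply: measurable_funTS; exact: measurableT_comp.
- by apply: filterS f0 => x f0 _ /=; rewrite ger0_norm.
Qed.

Lemma density_ge0 (A : set T) : measurable A -> 0 <= density fp A.
Proof. by move=> mA; rewrite density_abs// integral_ge0. Qed.

Lemma charge_integral_density (g : T -> R) :
  measurable_fun setT g -> bounded_fun g -> (forall x, (0 <= g x)%R) ->
  (charge_integral (density fp) g)%:E = \int[nu]_x (g x * `|f x|)%:E.
Proof.
move=> mg bg g0; rewrite (charge_integral_nonneg density_ge0)//.
apply: ge0_integral_density => //.
  by apply: measurableT_comp => //; exact: Lp_plus_measurable.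
move=> A mA; rewrite -density_abs//.
exact: jordan_pos_nonneg density_ge0 mA.
Qed.

End density_integral.

Lemma limn_einf_lt_frequently (R : realType) (u : (\bar R)^nat) (y : \bar R) :
  limn_einf u < y -> forall n, exists2 m, (n <= m)%N & u m < y.
Proof.
rewrite limn_einf_lim => uy n.
have : einfs u n < y.
  apply: le_lt_trans uy.
  have -> := cvg_lim (@ereal_hausdorff R) (@cvg_einfs_sup R u).
  by apply: ereal_sup_ubound; exists n.
by move=> /ereal_inf_lt[_ [m /= nm <-]] umy; exists m.
Qed.

Lemma cvg_le_frequently (R : realType) (a : nat -> R) (l : R) (B : \bar R) :
  a n @[n --> \oo] --> l -> (forall n, exists2 m, (n <= m)%N & (a m)%:E <= B) ->
  l%:E <= B.
Proof.
case: B => [b||] al aB; last 2 first.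
- by rewrite leey.
- by have [m _] := aB 0%N.
rewrite lee_fin leNgt; apply/negP => bl.
have [n _ na] := cvgr_gt _ al _ bl.
have [m nm] := aB n; rewrite lee_fin leNgt => /negP; apply.
exact: na.
Qed.

Lemma weak_cvg_charge_integral (R : realType) (S : ptopologicalType)
    (mu_ : nat -> weak_measures R S) (mu : weak_measures R S)
    (g : borel S -> R) :
  mu_ @ \oo --> mu -> continuous g -> bounded_fun g ->
  charge_integral (mu_ n : signed_measure R S) g @[n --> \oo] -->
  charge_integral (mu : signed_measure R S) g.
Proof.
move=> muc cg bg; pose G : bounded_continuous R S := exist _ g (conj cg bg).
have := cvg_comp _ _ muc (@initial_continuous _ _ (@pairing R S) mu).
move=> muG.
(* The projections are continuous when the index type has a decidable equality,
   which classic provides. *)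
exact: (cvg_comp _ _ muG
  (@proj_continuous {classic (bounded_continuous R S)} (fun=> R) G (pairing mu))).
Qed.

(** * Restriction of a measure to a set *)

Section restriction.
Context d (T : measurableType d) (R : realType).
Variables (nu : {measure set T -> \bar R}) (D : set T) (mD : measurable D).

Lemma ge0_integral_mrestr (g : T -> R) : measurable_fun setT g ->
  (forall x, (0 <= g x)%R) ->
  \int[mrestr nu mD]_x (g x)%:E = \int[nu]_x (g x * \1_D x)%:E.
Proof.
move=> mg g0; apply: ge0_integral_density => // A mA.
by rewrite integral_indic//= /mrestr setIC.
Qed.

Lemma Lnorm_mrestr_le (p : \bar R) (g : T -> R) : 1 < p -> measurable_fun setT g ->
  'N[mrestr nu mD]_p[EFin \o g] <= 'N[nu]_p[EFin \o (fun x => g x * \1_D x)%R].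
Proof.
move=> p1 mg; case: p p1 => [r|_|//].
  rewrite lte_fin => p1.
  have r0 : (r != 0)%R by rewrite gt_eqF// (lt_trans ltr01).
  rewrite !Lnorm_EFinE ge0_integral_mrestr.
  - rewrite le_eqVlt; apply/orP; left; apply/eqP; congr (_ `^ _).
    apply: eq_integral => x _; rewrite indicE.
    by case: (x \in D); rewrite ?mulr1// !mulr0 normr0 powR0.
  - by apply: (measurableT_comp (measurable_powR _)); exact: measurableT_comp.
  - by move=> x; exact: powR_ge0.
rewrite unlock; case: ifPn => nuD; last first.
  by case: ifPn => // nuT; apply: ess_sup_gee => //; apply: nearW => x /=.
have nuT : 0 < nu setT.
  have {nuD} : 0 < nu (setT `&` D) by exact: nuD.
  rewrite setTI => /lt_le_trans; apply.
  by apply: le_measure; rewrite ?inE.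
rewrite nuT; apply/ess_supP.
have [N [mN N0 gN]] := ess_sup_ge nu (abse \o (EFin \o (fun x => g x * \1_D x)%R)).
exists (N `|` ~` D); split.
- by apply: measurableU => //; exact: measurableC.
- suff : nu ((N `|` ~` D) `&` D) = 0 by [].
  rewrite setIUl setICl setU0; apply: subset_measure0 N0 => //.
  exact: measurableI.
- move=> x /= gx; have [Dx|] := pselect (D x); last by right.
  left; apply: gN => /=; apply: contra_not gx.
  by rewrite indicE mem_set// mulr1.
Qed.

Lemma Lnorm_ae_eq (p : \bar R) (f g : T -> R) : 1 < p ->
  measurable_fun setT f -> measurable_fun setT g ->
  (\forall x \ae nu, f x = g x) ->
  'N[nu]_p[EFin \o f] = 'N[nu]_p[EFin \o g].
Proof.
move=> p1 mf mg fg; case: p p1 => [r _|_|//].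
  rewrite !Lnorm_EFinE; congr (_ `^ _); apply: ge0_ae_eq_integral => //.
  - apply/measurable_EFinP; apply: (measurableT_comp (measurable_powR _)).
    exact: measurableT_comp.
  - apply/measurable_EFinP; apply: (measurableT_comp (measurable_powR _)).
    exact: measurableT_comp.
  - by apply: filterS fg => x /= ->.
rewrite unlock; case: ifPn => // _; apply: eq_ess_sup.
by apply: filterS fg => x /= ->.
Qed.

End restriction.

(** * Positivity, carrier and domination of a weak limit *)

Section weak_limits.
Variables (R : realType) (S : ptopologicalType).

Lemma bounded_integral_fin_num (mu : {finite_measure set (borel S) -> \bar R})
    (g : borel S -> R) :
  continuous g -> bounded_fun g -> \int[mu]_x (g x)%:E \is a fin_num.
Proof.
move=> cg bg; apply: integrable_fin_num => //.
apply: bounded_measurable_integrable => //.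
- by rewrite ltey_eq fin_num_measure.
- exact: continuous_borel_measurable.
Qed.

Lemma charge_integralE (mu : {charge set (borel S) -> \bar R}) (g : borel S -> R) :
  continuous g -> bounded_fun g ->
  (charge_integral mu g)%:E =
  \int[jordan_pos (hahnP mu)]_x (g x)%:E - \int[jordan_neg (hahnP mu)]_x (g x)%:E.
Proof.
move=> cg bg; rewrite /charge_integral /Rintegral EFinB.
by rewrite !fineK//; exact: bounded_integral_fin_num.
Qed.

(** By hypothesis [int g dmu^- <= int g dmu^+] for continuous [g >= 0], and the
    transfer principle extends this to the indicator of the negative set [N] of
    the Hahn decomposition: [mu^-(N) <= mu^+(N) = 0]. *)
Lemma charge_ge0_of_integrals (mu : {charge set (borel S) -> \bar R}) :
  completely_metrizable R S ->
  (forall g : borel S -> R, continuous g -> bounded_fun g ->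
    (forall x, (0 <= g x)%R) -> (0 <= charge_integral mu g)%R) ->
  forall A, measurable A -> 0 <= mu A.
Proof.
move=> mS mu_ge0 A mA; set PN := hahnP mu.
have [_ [mN _] _ _] := PN; set N := hahn_neg mu in PN mN.
have jp_oo : jordan_pos PN setT < +oo by rewrite ltey_eq fin_num_measure.
have negN : jordan_neg PN N <= 0.
  have : \int[jordan_neg PN]_x (\1_N x)%:E <=
      0 + \int[jordan_pos PN]_x (idfun (\1_N x : R))%:E.
    apply: (integral_bound_transfer _ _ _ mS (finite_outer_regular mS jp_oo) _
      _ _ measurableT jp_oo) => //.
    - exact: measurable_id.
    - by move=> s t /andP[].
    - move=> g cg bg g0; rewrite add0e -suber_ge0.
        by rewrite -charge_integralE// lee_fin mu_ge0.
      exact: bounded_integral_fin_num.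
    - by move=> x /(_ I).
  rewrite add0e [leRHS](_ : _ = \int[jordan_pos PN]_x (\1_N x)%:E)//.
  rewrite !integral_indic// !setIT.
  move=> /le_trans; apply; rewrite le_eqVlt; apply/orP; left; apply/eqP.
  exact: jordan_pos_hahn_neg.
rewrite (jordan_pos_sub_neg PN mA).
have -> : jordan_neg PN A = 0; last by rewrite sube0.
apply/eqP; rewrite eq_le measure_ge0 andbT; apply: le_trans negN.
have mAN : measurable (A `&` N) by exact: measurableI.
have -> : jordan_neg PN A = jordan_neg PN (A `&` N).
  by rewrite !jordan_negE_hahn// -setIA setIid.
by apply: le_measure; rewrite ?inE//; exact: subIsetr.
Qed.

Lemma sigma_compact_carrier (m_ : nat -> {measure set (borel S) -> \bar R}) :
  polish R S -> (forall i, m_ i setT < +oo) ->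
  exists2 K : (set (borel S))^nat, forall n, compact (K n) &
    forall i, m_ i (~` \bigcup_n K n) = 0.
Proof.
move=> pS moo.
have /choice[K KP] i : exists K : (set (borel S))^nat,
    (forall n, compact (K n)) /\ m_ i (~` \bigcup_n K n) = 0.
  by have [K cK K0] := tight_sigma_compact pS (moo i); exists K.
(* Merges the carriers of the countably many measures into one sequence. *)
pose e (j : nat) : nat * nat := odflt (0, 0)%N (unpickle j).
have cmK i n : measurable (K i n).
  apply: closed_borel_measurable; apply: compact_closed; last exact: (KP i).1.
  exact: (completely_metrizable_hausdorff pS.2).
exists (fun j => K (e j).1 (e j).2) => [j|i]; first exact: (KP _).1.
apply: subset_measure0 (KP i).2.
- by apply: measurableC; exact: bigcup_measurable.
- by apply: measurableC; exact: bigcup_measurable.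
- apply: subsetC => x [n _ Kx]; exists (pickle (i, n)) => //.
  by rewrite /e pickleK.
Qed.

Section young_bound.
Variables (m nu : {measure set (borel S) -> \bar R}) (p : \bar R) (M : R).
Hypotheses (mS : completely_metrizable R S) (nureg : outer_regular nu).
Hypotheses (p1 : 1 < p) (M0 : (0 <= M)%R).
Hypothesis cont_bound : forall g : borel S -> R, continuous g -> bounded_fun g ->
  (forall x, (0 <= g x)%R) ->
  \int[m]_x (g x)%:E <= young_cst p M + \int[nu]_x (young_fun p M (g x))%:E.

Lemma young_bound_transfer (phi : borel S -> R) (E : set (borel S)) :
  measurable_fun setT phi -> (forall x, (0 <= phi x)%R) ->
  measurable E -> nu E < +oo -> (forall x, ~ E x -> phi x = 0%R) ->
  \int[m]_x (phi x)%:E <= young_cst p M + \int[nu]_x (young_fun p M (phi x))%:E.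
Proof.
apply: integral_bound_transfer => //.
- exact: measurable_young_fun.
- by move=> t; exact: young_fun_ge0.
- by move=> s t; exact: young_fun_nondecreasing.
Qed.

(** On a null set the [nu]-integral vanishes, so [t m(E) <= C] for every
    [t >= 0]. *)
Lemma young_dominates (E : set (borel S)) : measurable E -> nu E = 0 -> m E = 0.
Proof.
move=> mE E0.
have tE (t : R) : (0 <= t)%R -> t%:E * m E <= young_cst p M.
  move=> t0.
  have := @young_bound_transfer (fun x => t * \1_E x)%R E.
  have -> : \int[m]_x (t * \1_E x)%:E = t%:E * m E.
    under eq_integral do rewrite EFinM.
    by rewrite ge0_integralZl ?integral_indic ?setIT//; exact/measurable_EFinP.
  have -> : \int[nu]_x (young_fun p M (t * \1_E x))%:E = 0.
    rewrite (ae_eq_integral (cst 0)) ?integral0//.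
    - apply/measurable_EFinP.
      apply: (measurableT_comp (measurable_young_fun p M)).
      exact: measurable_funM.
    - exists E; split => // x /=; apply: contra_notP => nEx _.
      by rewrite indicE memNset// mulr0 young_fun0.
  rewrite adde0; apply=> //.
  - exact: measurable_funM.
  - by move=> x; rewrite mulr_ge0.
  - by rewrite E0.
  - by move=> x nEx; rewrite indicE memNset// mulr0.
apply/eqP; rewrite eq_le measure_ge0 andbT leNgt; apply/negP => mE0.
have Cfin := young_cst_fin_num p M.
case: (m E) mE0 tE => [a||//].
- rewrite lte_fin => a0 /(_ ((fine (young_cst p M) + 1) / a)%R).
  rewrite -EFinM divfK ?gt_eqF// -(fineK Cfin) lee_fin /= => H.
  have : (fine (young_cst p M) + 1 <= fine (young_cst p M))%R.
    apply: H; rewrite divr_ge0 ?(ltW a0)// addr_ge0//.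
    by rewrite fine_ge0// young_cst_ge0.
  by rewrite gerDl ler10.
- move=> _ /(_ 1%R ler01); rewrite mul1e leye_eq => /eqP Cy.
  by rewrite Cy in Cfin.
Qed.

Lemma Lnorm_density_le (f : borel S -> R) (F : (set (borel S))^nat) :
  measurable_fun setT f -> (forall x, (0 <= f x)%R) ->
  (forall A, measurable A -> m A = \int[nu]_(x in A) (f x)%:E) ->
  (forall k, measurable (F k)) -> nondecreasing_seq F ->
  (forall k, nu (F k) < +oo) ->
  (forall x, ~ (\bigcup_k F k) x -> f x = 0%R) ->
  'N[nu]_p[EFin \o f] <= M%:E.
Proof.
move=> mf f0 mE mF ndF Foo fF; apply: (Lnorm_le_of_young p1 M0 mf f0 mF ndF Foo fF).
move=> phi k mphi phi0 phiF.
rewrite -(ge0_integral_density mf f0 mE mphi phi0).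
exact: young_bound_transfer phiF.
Qed.

End young_bound.
End weak_limits.

(** * The density of the limit *)

Section Lp_densities.
Variables (R : realType) (S : ptopologicalType).
Variables (nu : {measure set (borel S) -> \bar R}) (p : \bar R).
Variables (mu : {charge set (borel S) -> \bar R}) (M : \bar R).
Variables (D : set (borel S)) (mD : measurable D)
  (sf : sigma_finite [set: borel S] (mrestr nu mD)) (F : (set (borel S))^nat).
Hypotheses (mS : completely_metrizable R S) (nureg : outer_regular nu).
Hypotheses (p1 : 1 < p) (M0 : 0 <= M) (Moo : M < +oo).
Hypotheses (mu0 : forall A, measurable A -> 0 <= mu A)
  (muD : forall A, measurable A -> A `&` D = set0 -> mu A = 0).
Hypotheses (mF : forall k, measurable (F k)) (ndF : nondecreasing_seq F)
  (Foo : forall k, nu (F k) < +oo) (FD : \bigcup_k F k = D).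
Hypothesis cont_bound : forall (M' : R) (g : borel S -> R), M < M'%:E ->
  continuous g -> bounded_fun g -> (forall x, (0 <= g x)%R) ->
  \int[jordan_pos (hahnP mu)]_x (g x)%:E <=
    young_cst p M' + \int[nu]_x (young_fun p M' (g x))%:E.

Let jp := jordan_pos (hahnP mu).
Let jpE A : measurable A -> jp A = mu A.
Proof. by move=> mA; exact: jordan_pos_nonneg. Qed.

Let Mfin : M \is a fin_num. Proof. by rewrite ge0_fin_numE. Qed.

Let M_lt (e : R) : (0 < e)%R -> M < (fine M + e)%:E.
Proof. by move=> e0; rewrite -[X in X < _](fineK Mfin) lte_fin ltrDl. Qed.

Let M_add_ge0 (e : R) : (0 < e)%R -> (0 <= fine M + e)%R.
Proof. by move=> e0; rewrite addr_ge0 ?fine_ge0// ltW. Qed.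

Local Notation nuD := (sigma_finite_mrestr sf).

Lemma Lp_limit_dominated : mu `<< nu.
Proof.
apply/null_content_dominatesP => A mA A0; rewrite -jpE//.
apply: (@young_dominates R S jp nu p (fine M + 1)) => //.
- exact: M_add_ge0.
- by move=> g cg bg g0; apply: cont_bound => //; exact: M_lt.
Qed.

Lemma Lp_limit_dominated_restr : mu `<< nuD.
Proof.
apply/null_content_dominatesP => A mA A0.
have mAD : measurable (A `&` D) by exact: measurableI.
have mAnD : measurable (A `\` D) by exact: measurableD.
rewrite -(setUIDK A D) chargeU//; last by rewrite setDE setIACA setICr setI0.
rewrite (muD mAnD) ?adde0; last by rewrite setDE -setIA setICl setI0.
by have /null_content_dominatesP := Lp_limit_dominated; apply.
Qed.

(** The Radon-Nikodym derivative of a charge is determined only almost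
    everywhere and may be negative on a null set; [f0] is a version that is
    nonnegative and vanishes off [D] at every point, as the test functions built
    from it require. *)
Lemma Lp_limit_density : exists f0 : borel S -> R,
  [/\ measurable_fun setT f0, forall x, (0 <= f0 x)%R,
      (\forall x \ae nu, (fine (('d mu '/d nuD) x) * \1_D x = f0 x)%R),
      forall x, ~ D x -> f0 x = 0%R &
      forall A, measurable A -> mu A = \int[nu]_(x in A) (f0 x)%:E].
Proof.
have jp_dom : jp `<< nuD by exact: jordan_pos_dominates Lp_limit_dominated_restr.
have [h [h0 hfin ih jph]] := radon_nikodym_sigma_finite jp_dom.
have muh A : measurable A -> mu A = \int[nuD]_(x in A) h x.
  by move=> mA; rewrite -jpE//; exact: jph.
have mh : measurable_fun setT (fun x => fine (h x)).
  by apply: measurableT_comp => //; exact: measurable_int ih.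
have RN_h : ae_eq nuD setT ('d mu '/d nuD) h.
  apply: integral_ae_eq => //.
  - exact: Radon_Nikodym_integrable Lp_limit_dominated_restr.
  - exact: measurable_int ih.
  - move=> A _ mA; rewrite -muh//.
    by rewrite -Radon_Nikodym_integral//; exact: Lp_limit_dominated_restr.
exists (fun x => fine (h x) * \1_D x)%R; split.
- exact: measurable_funM.
- by move=> x; rewrite mulr_ge0// fine_ge0.
- have [N [mN N0 hN]] := RN_h; exists (N `&` D); split => //.
    exact: measurableI.
  move=> x /= hx; split; last first.
    by apply: contrapT => nDx; apply: hx; rewrite indicE memNset// !mulr0.
  by apply: hN => /= /(_ I) hx'; apply: hx; rewrite hx'.
- by move=> x nDx; rewrite indicE memNset// mulr0.
- move=> A mA; rewrite muh//.
  rewrite integral_mkcond [RHS]integral_mkcond.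
  transitivity (\int[mrestr nu mD]_x (fine (h x) * \1_A x)%:E).
    apply: eq_integral => x _; rewrite patchE indicE.
    by case: (x \in A); rewrite ?mulr1 ?fineK// mulr0.
  rewrite ge0_integral_mrestr.
  + apply: eq_integral => x _; rewrite patchE !indicE.
    by case: (x \in A); rewrite ?mulr1 ?mulr0 ?mul0r.
  + exact: measurable_funM.
  + by move=> x; rewrite mulr_ge0// fine_ge0.
Qed.

Lemma Lp_limit_regular :
  let fstar := fine \o 'd mu '/d nuD in
  [/\ fstar \in Lfun nuD p, 'N[nuD]_p[EFin \o fstar] <= M &
      let f := (fun x => fstar x * \1_D x)%R in
      [/\ forall A, measurable A -> mu A = \int[nu]_(x in A) (f x)%:E,
          Lp_plus nu p f & 'N[nu]_p[EFin \o f] <= M]].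
Proof.
move=> fstar.
have [f0 [mf0 f0_ge0 f_f0 f0D muE]] := Lp_limit_density.
have mfstar : measurable_fun setT fstar.
  apply: measurableT_comp => //; apply: measurable_int.
  exact: Radon_Nikodym_integrable Lp_limit_dominated_restr.
have Nf0 : 'N[nu]_p[EFin \o f0] <= M.
  apply/lee_addgt0Pr => e e0; rewrite -(fineK Mfin) -EFinD.
  apply: (@Lnorm_density_le R S jp nu p _ mS nureg p1 (M_add_ge0 e0) _
    f0 F) => //.
  - by move=> g cg bg g0; apply: cont_bound => //; exact: M_lt.
  - by move=> A mA; rewrite -muE// -jpE.
  - by rewrite FD.
pose f := (fun x => fstar x * \1_D x)%R.
have mf : measurable_fun setT f by exact: measurable_funM.
have Nf : 'N[nu]_p[EFin \o f] <= M.
  by rewrite (Lnorm_ae_eq p1 mf mf0 f_f0).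
have Nfstar : 'N[nuD]_p[EFin \o fstar] <= M.
  by apply: le_trans Nf; exact: Lnorm_mrestr_le.
have muEf A : measurable A -> mu A = \int[nu]_(x in A) (f x)%:E.
  move=> mA; rewrite muE//; apply: ae_eq_integral => //.
  - by apply/measurable_EFinP; exact: measurable_funTS.
  - by apply/measurable_EFinP; exact: measurable_funTS.
  - by apply: filterS f_f0 => x fx _ /=; rewrite -fx.
have LfunP g : forall m : {measure set (borel S) -> \bar R},
    measurable_fun setT g -> 'N[m]_p[EFin \o g] <= M -> g \in Lfun m p.
  move=> m mg gM; apply/andP; rewrite !inE; split=> //=.
  by rewrite /finite_norm (le_lt_trans gM).
split; [exact: LfunP|exact: Nfstar|split; [exact: muEf| |exact: Nf]].
split.
- apply/Lfun1_integrable/integrableP; split; first exact/measurable_EFinP.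
  rewrite (ae_eq_integral (EFin \o f0)) => [||||] //.
  + rewrite -muE// ltey_eq fin_num_measure//.
  + by apply: measurableT_comp => //; exact/measurable_EFinP.
  + exact/measurable_EFinP.
  + by apply: filterS f_f0 => x + _ /= => ->; rewrite ger0_norm.
- exact: LfunP.
- by apply: filterS f_f0 => x ->.
Qed.

End Lp_densities.

Lemma total_variation_nonneg d (T : measurableType d) (R : realType)
    (mu : {charge set T -> \bar R}) (A : set T) :
  (forall B, measurable B -> 0 <= mu B) -> measurable A ->
  Defs.total_variation mu A = mu A.
Proof.
move=> mu0 mA; rewrite /Defs.total_variation/= /charge_variation.
have -> : jordan_pos (hahnP mu) A = mu A by exact: jordan_pos_nonneg.
have -> : jordan_neg (hahnP mu) A = 0 by exact: jordan_neg_nonneg.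
by rewrite adde0.
Qed.

Theorem theorem3p1 (R : realType) (S : ptopologicalType)
    (nu : {measure set (borel S) -> \bar R}) (p : \bar R)
    (f_ : (borel S -> R)^nat) (mustar : {charge set (borel S) -> \bar R})
    (polishS : polish R S) (radon_nu : radon nu) (p_gt1 : 1 < p)
    (f_Lp : forall n, Lp_plus nu p (f_ n)) :
  let mu_ n := density (f_Lp n) in
  (fun n => mu_ n : weak_measures R S) @ \oo --> (mustar : weak_measures R S) ->
  exists (Sstar : set (borel S)) (mSstar : measurable Sstar)
         (sfin : sigma_finite [set: borel S] (mrestr nu mSstar)),
    [/\ sigma_compact Sstar,
        forall n, concentrated (mu_ n) Sstar &
        concentrated mustar Sstar] /\
    let nustar := sigma_finite_mrestr sfin in
    let M := limn_einf (fun n => 'N[nu]_p[EFin \o f_ n]) in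
    M < +oo ->
    [/\ mustar `<< nustar, mustar `<< nu &
        let fstar := fine \o 'd mustar '/d nustar in
        [/\ fstar \in Lfun nustar p, 'N[nustar]_p[EFin \o fstar] <= M &
            let f := (fun x => fstar x * \1_Sstar x)%R in
            [/\ forall A, measurable A ->
                  mustar A = \int[nu]_(x in A) (f x)%:E,
                Lp_plus nu p f & 'N[nu]_p[EFin \o f] <= M]]].
Proof.
move=> mu_ mu_mustar.
have mS := polishS.2.
have mu_cvg (g : borel S -> R) : continuous g -> bounded_fun g ->
    charge_integral (mu_ n) g @[n --> \oo] --> charge_integral mustar g.
  exact: weak_cvg_charge_integral mu_mustar.
have mu_ge0 n A : measurable A -> 0 <= mu_ n A by exact: density_ge0.
have mustar_ge0 A : measurable A -> 0 <= mustar A.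
  apply: (charge_ge0_of_integrals mS) => g cg bg g0.
  have gcvg := mu_cvg g cg bg.
  have <- := cvg_lim (@Rhausdorff R) gcvg.
  apply: limr_ge; first by apply/cvg_ex; eexists; exact: gcvg.
  apply: nearW => n; rewrite -lee_fin charge_integral_density//; last first.
    exact: continuous_borel_measurable.
  by apply: integral_ge0 => x _; rewrite lee_fin mulr_ge0.
have [nu_compact nureg _] := radon_nu.
pose m_ i : {measure set (borel S) -> \bar R} :=
  if i is n.+1 then Defs.total_variation (mu_ n) else Defs.total_variation mustar.
have m_oo i : m_ i setT < +oo.
  case: i => [|n].
    have -> : m_ 0%N setT = mustar setT by exact: total_variation_nonneg.
    by rewrite ltey_eq fin_num_measure.
  have -> : m_ n.+1 setT = mu_ n setT.
    by apply: total_variation_nonneg => //; exact: mu_ge0.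
  by rewrite ltey_eq fin_num_measure.
have [K cK K0] := sigma_compact_carrier polishS m_oo.
have haus := completely_metrizable_hausdorff mS.
have mK n : measurable (K n).
  by apply: closed_borel_measurable; exact: (@compact_closed (borel S)).
pose D := \bigcup_n K n.
have mD : measurable D by exact: bigcup_measurable.
have sf : sigma_finite [set: borel S] (mrestr nu mD).
  exists (fun n => K n `|` ~` D).
    apply/esym; rewrite -subTset => x _.
    have [[n _ Kx]|nDx] := pselect (D x); first by exists n => //; left.
    by exists 0%N => //; right.
  move=> n; split; first by apply: measurableU => //; exact: measurableC.
  rewrite /mrestr setIUl setICl setU0.
  apply: le_lt_trans (nu_compact _ (cK n)).
  by apply: le_measure; rewrite ?inE//; exact: measurableI.
exists D, mD, sf; split; first split.
- by exists K.
- by move=> n; exact: (K0 n.+1).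
- exact: (K0 0%N).
move=> nustar M Moo.
have M0 : 0 <= M.
  rewrite /M limn_einf_lim; apply: lime_ge; first exact: is_cvg_einfs.
  by apply: nearW => n; apply: le_ereal_inf_tmp => _ [k _ <-]; exact: Lnorm_ge0.
pose F k := \big[setU/set0]_(i < k.+1) K i.
(* Infinitely many of the norms lie below M', which suffices to bound the limit
   of a convergent sequence of integrals. *)
have cont_bound (M' : R) (g : borel S -> R) : M < M'%:E ->
    continuous g -> bounded_fun g -> (forall x, (0 <= g x)%R) ->
    \int[jordan_pos (hahnP mustar)]_x (g x)%:E <=
      young_cst p M' + \int[nu]_x (young_fun p M' (g x))%:E.
  move=> MM' cg bg g0; have mg := continuous_borel_measurable cg.
  have M'0 : (0 <= M')%R by rewrite -lee_fin (le_trans M0)// ltW.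
  rewrite -charge_integral_nonneg//.
  apply: cvg_le_frequently (mu_cvg g cg bg) _ => n.
  have [k nk fkM'] := limn_einf_lt_frequently MM' n.
  exists k => //; rewrite charge_integral_density//.
  apply: young_integral_le => //; last exact: ltW.
  exact: (Lp_plus_measurable (f_Lp k)).
have mustarD A : measurable A -> A `&` D = set0 -> mustar A = 0.
  move=> mA AD; rewrite -total_variation_nonneg//.
  apply: subset_measure0 (K0 0%N) => //; first exact: measurableC.
  exact/disjoints_subset.
have mF k : measurable (F k) by exact: bigsetU_measurable.
have ndF : nondecreasing_seq F.
  by move=> i j ij; apply/subsetPset; exact: subset_bigsetU.
have Foo k : nu (F k) < +oo.
  apply: nu_compact; apply: bigsetU_compact => i _; exact: cK.
have FD : \bigcup_k F k = D.
  apply/seteqP; split=> [x [k _]|x [k _ Kx]].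
    by rewrite /F -bigcup_mkord => -[i _ Kx]; exists i.
  by exists k => //; rewrite /F big_ord_recr/=; right.
split.
- exact: (@Lp_limit_dominated_restr R S nu p mustar M D mD sf).
- exact: (@Lp_limit_dominated R S nu p mustar M).
- exact: (@Lp_limit_regular R S nu p mustar M D mD sf F).
Qed.
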